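(* Let $n\ge2$, let $\zeta_1,\dots,\zeta_M$ be distinct points of $\mathbb{D}$ and let $W_1,\dots,W_M\in\Omega_{1,n}$. Write $\pi_n=(X,Y)$. If there exists a holomorphic map $F:\mathbb{D}\to\Omega_{1,n}$ with $F(\zeta_j)=W_j$ for every $j$, then for each $z\in\overline{\mathbb{D}}$ the $M\times M$ matrix \[ M_z:=\left[\frac{1-\overline{\Psi_n(z;X(W_j),Y(W_j))}\,\Psi_n(z;X(W_k),Y(W_k))}{1-\overline{\zeta_j}\zeta_k}\right]_{j,k=1}^M \] is positive semi-definite (in particular, each $\Psi_n(\cdot;X(W_j),Y(W_j))$ has no poles in $\overline{\mathbb{D}}$).
   Context: $\mathbb{D}$ is the open unit disc. For $A\in\mathbb{C}^{n\times n}$, $A_I$ ($I$ an increasing $j$-tuple in $\{1,\dots,n\}$) is the principal submatrix with rows and columns indexed by $I$; $\mathscr{I}^j$ is the set of such $j$-tuples. $\mu_E(A):=\big(\inf\{\|X\|: X\in E,\ \mathbb{I}-AX \text{ singular}\}\big)^{-1}$ (operator norm), $E^{1,n}:=\{[w]\oplus(z\mathbb{I}_{n-1}): z,w\in\mathbb{C}\}$, $\Omega_{1,n}:=\{A:\mu_{E^{1,n}}(A)<1\}$. The map $\pi_n=(X,Y):\mathbb{C}^{n\times n}\to\mathbb{C}^n\times\mathbb{C}^{n-1}$: $X_1(A)=a_{1,1}$, $X_j(A)=\sum_{I\in\mathscr{I}^j: i_1=1}\det(A_I)$ ($2\le j\le n$), $Y_j(A)=\sum_{I\in\mathscr{I}^j: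 i_1\ge2}\det(A_I)$ ($1\le j\le n-1$). For $(x,y)\in\mathbb{C}^n\times\mathbb{C}^{n-1}$: $P_n(z;x):=\sum_{j=0}^{n-1}(-1)^jx_{j+1}z^j$, $Q_n(z;y):=1+\sum_{j=1}^{n-1}(-1)^jy_jz^j$, and $\Psi_n(\cdot;x,y)$ is the rational function $P_n(\cdot;x)/Q_n(\cdot;y)$ after cancelling all common linear factors of numerator and denominator. *)

(* Defs.v *)
(* The complex plane is modelled by an arbitrary
   numClosedFieldType C whose real subfield is Dedekind complete
   (such a C is isomorphic to the field of complex numbers). *)
From HB Require Import structures.
From mathcomp Require Import all_boot all_order all_algebra.
Set Implicit Arguments. Unset Strict Implicit. Unset Printing Implicit Defensive.
Import Order.TTheory GRing.Theory Num.Theory.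
Local Open Scope ring_scope.

Section Defs.
Variable C : numClosedFieldType.

(* Dedekind completeness of the reals of C: C is then (isomorphic to) the complex field. *)
Definition real_complete : Prop :=
  forall S : C -> Prop,
    (forall x, S x -> x \is Num.real) ->
    (exists x, S x) ->
    (exists M, M \is Num.real /\ forall x, S x -> x <= M) ->
    exists s, s \is Num.real /\ (forall x, S x -> x <= s) /\
      (forall M, M \is Num.real -> (forall x, S x -> x <= M) -> s <= M).

Definition in_disc (z : C) : bool := `|z| < 1.
Definition in_cdisc (z : C) : bool := `|z| <= 1.

Definition cdifferentiable (f : C -> C) (z0 : C) : Prop :=
  exists d : C, forall eps : C, 0 < eps -> exists delta : C, 0 < delta /\
    forall z, `|z - z0| < delta -> `|f z - f z0 - d * (z - z0)| <= eps * `|z - z0|.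

Definition holo_disc_mx (n : nat) (F : C -> 'M[C]_n) : Prop :=
  forall z, in_disc z -> forall i j, cdifferentiable (fun w => F w i j) z.

Definition opnorm_le (n : nat) (X : 'M[C]_n) (t : C) : Prop :=
  0 <= t /\ forall v : 'cV[C]_n,
    \sum_i `|(X *m v) i 0| ^+ 2 <= t ^+ 2 * \sum_i `|v i 0| ^+ 2.

Definition E1n (n : nat) (z w : C) : 'M[C]_n :=
  \matrix_(i, j) (if i == j then (if val i == 0%N then w else z) else 0).

(* A \in Omega_{1,n}, i.e. mu_{E^{1,n}}(A) < 1, i.e.
   inf { ||X|| : X \in E^{1,n}, I - A X singular } > 1 (inf of empty set = +oo);
   "r <= ||X||" is expressed as: every t with ||X|| <= t satisfies r <= t. *)
Definition Omega1n (n : nat) (A : 'M[C]_n) : Prop :=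
  exists r : C, 1 < r /\
    forall z w : C, \det (1%:M - A *m E1n n z w) = 0 ->
      forall t, opnorm_le (E1n n z w) t -> r <= t.

Definition pminor (n : nat) (A : 'M[C]_n) (S : {set 'I_n}) : C :=
  \det (\matrix_(a < #|S|, b < #|S|) A (enum_val a) (enum_val b)).

Definition Xc (n : nat) (A : 'M[C]_n) (j : nat) : C :=
  \sum_(S : {set 'I_n} | (#|S| == j) && [exists i in S, val i == 0%N]) pminor A S.

Definition Yc (n : nat) (A : 'M[C]_n) (j : nat) : C :=
  \sum_(S : {set 'I_n} | (#|S| == j) && [forall i in S, val i != 0%N]) pminor A S.

Definition Ppoly (n : nat) (A : 'M[C]_n) : {poly C} :=
  \poly_(j < n) ((-1) ^+ j * Xc A j.+1).
Definition Qpoly (n : nat) (A : 'M[C]_n) : {poly C} :=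
  \poly_(j < n) (if j == 0%N then 1 else (-1) ^+ j * Yc A j).

Definition Pred (n : nat) (A : 'M[C]_n) : {poly C} :=
  Ppoly A %/ gcdp (Ppoly A) (Qpoly A).
Definition Qred (n : nat) (A : 'M[C]_n) : {poly C} :=
  Qpoly A %/ gcdp (Ppoly A) (Qpoly A).

(* value of Psi_n(z; X(A), Y(A)) (meaningful where Qred A has no root) *)
Definition Psi (n : nat) (A : 'M[C]_n) (z : C) : C :=
  (Pred A).[z] / (Qred A).[z].

Definition psd (m : nat) (H : 'M[C]_m) : Prop :=
  forall v : 'cV[C]_m, 0 <= \sum_j \sum_k (v j 0)^* * H j k * v k 0.

End Defs.

(* Main.v *)
(* Expanding [det (I - A X)] for [X = [w] (+) z I] over principal minors gives
   [Q(z) - w P(z)].  On [Omega_{1,n}] this does not vanish for [|z|, |w| <= 1], so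
   [Q(z) <> 0] and [|P(z) / Q(z)| <= 1].  For fixed [z], [f = Psi(z; pi_n o F)] is then a
   holomorphic map of the disc into the closed disc, and it remains to prove the
   necessity half of the Nevanlinna-Pick theorem for [f].  This is the usual argument that
   multiplication by [f] is a contraction of the Hardy space whose adjoint maps the Szego
   kernel [k_zeta] to [conj (f zeta) k_zeta].

   Integrals are avoided: the Hardy inner product on the circle [|z| = r] is replaced
   by averages over the [2^e]-th roots of unity, which are positive for every [e], and
   Cauchy's formula is only needed in the limit [e -> oo].  It follows from Goursat's
   bisection, run on the homotopy [zeta + s (u - zeta)], [|u| = r], [s0 <= s <= 1], with
   trapezoid sums in place of contour integrals: they are additive and vanish exactly
   on closed polygons for affine integrands. *)
Require Import Defs.
From HB Require Import structures.
From mathcomp Require Import all_boot all_order all_algebra.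
From mathcomp Require Import perm zify ring.
From Stdlib Require Import Classical ClassicalEpsilon.
Set Implicit Arguments. Unset Strict Implicit. Unset Printing Implicit Defensive.
Import Order.TTheory GRing.Theory Num.Theory.
Local Open Scope ring_scope.

(** * Limits in a complete numClosedFieldType *)

Section Limits.
Variable C : numClosedFieldType.
Implicit Types (u v : nat -> C) (x y : C).

Definition cvgC u (l : C) := forall eps : C, 0 < eps ->
  exists N, forall n, (N <= n)%N -> `|u n - l| <= eps.

Lemma cvgC_cst l : cvgC (fun=> l) l.
Proof. by move=> e e0; exists 0 => n _; rewrite subrr normr0 ltW. Qed.

Lemma eq_cvgC u v l : (forall n, u n = v n) -> cvgC u l -> cvgC v l.
Proof.
by move=> uv ul e e0; have [N HN] := ul e e0; exists N => n /HN; rewrite uv.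
Qed.

Lemma cvgC_shift u l k : cvgC (fun n => u (n + k)%N) l -> cvgC u l.
Proof.
move=> ul e e0; have [N HN] := ul e e0; exists (N + k)%N => n Nn.
by rewrite -(subnK (leq_trans (leq_addl N k) Nn)); apply: HN; rewrite leq_subRL //; lia.
Qed.

Lemma cvgCD u v l x : cvgC u l -> cvgC v x -> cvgC (fun n => u n + v n) (l + x).
Proof.
move=> ul vx e e0; have e2 : 0 < e / 2 by rewrite divr_gt0.
have [N HN] := ul _ e2; have [N' HN'] := vx _ e2.
exists (maxn N N') => n; rewrite geq_max => /andP[/HN h1 /HN' h2].
rewrite opprD addrACA (le_trans (ler_normD _ _)) //.
by rewrite [e]splitr lerD.
Qed.

Lemma cvgCM u l x : cvgC u l -> cvgC (fun n => x * u n) (x * l).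
Proof.
move=> ul e e0; have x1 : 0 < `|x| + 1 by rewrite ltr_wpDl.
have [N HN] := ul _ (divr_gt0 e0 x1); exists N => n /HN h.
rewrite -mulrBr normrM.
apply: (@le_trans _ _ ((`|x| + 1) * (e / (`|x| + 1)))).
  by rewrite ler_pM // lerDl.
by rewrite mulrCA divff ?mulr1 // gt_eqF.
Qed.

Lemma cvgCN u l : cvgC u l -> cvgC (fun n => - u n) (- l).
Proof.
by move/(cvgCM (-1)); rewrite mulN1r; apply: eq_cvgC => n; rewrite mulN1r.
Qed.

Lemma cvgCB u v l x : cvgC u l -> cvgC v x -> cvgC (fun n => u n - v n) (l - x).
Proof. by move=> ul /cvgCN; apply: cvgCD. Qed.

Lemma cvgC_sum (I : Type) (r : seq I) (u : I -> nat -> C) (l : I -> C) :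
  (forall i, cvgC (u i) (l i)) ->
  cvgC (fun n => \sum_(i <- r) u i n) (\sum_(i <- r) l i).
Proof.
move=> ul; elim: r => [|i r IH].
  by rewrite big_nil; apply: eq_cvgC (cvgC_cst 0) => n; rewrite big_nil.
by rewrite big_cons; apply: eq_cvgC (cvgCD (ul i) IH) => n; rewrite big_cons.
Qed.

Lemma cvgC_conj u l : cvgC u l -> cvgC (fun n => (u n)^*) l^*.
Proof.
move=> ul e e0; have [N HN] := ul e e0; exists N => n /HN.
by rewrite -rmorphB norm_conjC.
Qed.

Lemma normC_ge_Re x : `|'Re x| <= `|x|.
Proof. exact: (leif_normC_Re_Creal x).1. Qed.

Lemma normC_ge_Im x : `|'Im x| <= `|x|.
Proof.
by rewrite -normrN -ReMil (le_trans (normC_ge_Re _)) // normrM normCi mul1r.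
Qed.

(** In [C] the relation [0 <= x] also says that [x] is real, so both parts must be controlled:
    ['Im x] is arbitrarily small and ['Re x] exceeds every negative number. *)
Lemma nonneg_closed x :
  (forall eps : C, 0 < eps -> exists2 y, 0 <= y & `|y - x| <= eps) -> 0 <= x.
Proof.
move=> h; have key e : 0 < e -> 0 <= 'Re x + e /\ `|'Im x| <= e.
  move=> e0; have [y y0 yx] := h e e0; have yR := ger0_real y0.
  have ryx : 'Re (y - x) = y - 'Re x by rewrite raddfB /= (Creal_ReP _ yR).
  have iyx : 'Im (y - x) = - 'Im x by rewrite raddfB /= (Creal_ImP _ yR) sub0r.
  split; last by rewrite -normrN -iyx (le_trans _ yx) // normC_ge_Im.
  have : y - 'Re x <= e.
    rewrite -ryx (le_trans _ yx) // (le_trans _ (normC_ge_Re _)) //.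
    by rewrite real_ler_norm ?Creal_Re.
  rewrite lerBlDr addrC; exact: le_trans.
have im0 : 'Im x = 0.
  apply/eqP; rewrite -normr_eq0 eq_le normr_ge0 andbT.
  rewrite real_leNgt ?real0 ?normr_real //; apply/negP => i0.
  have [_] := key _ (divr_gt0 i0 (ltr0n _ 2)).
  rewrite ler_pdivlMr // ger_pMr // => /le_trans; move/(_ _ (lexx _)).
  by rewrite (_ : 1 = 1%:R) // ler_nat.
rewrite [x]Crect im0 mulr0 addr0 real_leNgt ?real0 ?Creal_Re //.
apply/negP => r0; have [] := key (- 'Re x / 2); first by rewrite divr_gt0 ?oppr_gt0.
have -> : 'Re x + - 'Re x / 2 = 'Re x / 2 by field.
by rewrite pmulr_lge0 ?invr_gt0 // => /le_lt_trans /(_ r0); rewrite ltxx.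
Qed.

Lemma cvgC_ge0 u l : (forall n, 0 <= u n) -> cvgC u l -> 0 <= l.
Proof.
move=> u0 ul; apply: nonneg_closed => e /ul[N HN]; exists (u N) => //; exact: HN.
Qed.

(** * Consequences of completeness *)

Section Completeness.
Hypothesis Cc : real_complete C.

Lemma real_sup (S : C -> Prop) a b : S a -> (forall x, S x -> x \is Num.real) ->
  b \is Num.real -> (forall x, S x -> x <= b) ->
  exists s, s \is Num.real /\ (forall x, S x -> x <= s) /\
    (forall M, M \is Num.real -> (forall x, S x -> x <= M) -> s <= M).
Proof. by move=> Sa SR bR Sb; apply: Cc => //; [exists a | exists b]. Qed.

(** If all naturals were below [x], their supremum [s] would admit the smaller upper bound
    [s - 1]. *)
Lemma archimedean_of_complete x : x \is Num.real -> exists n : nat, x <= n%:R.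
Proof.
move=> xR; apply: NNPP => nx.
have lt_x n : (n%:R : C) < x.
  by rewrite real_ltNge ?realn //; apply/negP => h; apply: nx; exists n.
have [| | | |s [sR [s1 s2]]] := @real_sup (fun y => exists n : nat, y = n%:R) 0 x.
- by exists 0%N.
- by move=> _ [n ->]; apply: realn.
- by [].
- by move=> _ [n ->]; apply: ltW.
have : s <= s - 1.
  apply: s2; first by rewrite rpredB ?real1.
  by move=> _ [n ->]; rewrite lerBrDr; apply: s1; exists n.+1; rewrite natr1.
by rewrite lerBrDr gerDl ler10.
Qed.

(** Bernoulli's inequality for [1 + d], the inverse of [|x|], and the Archimedean property. The
    exponents [k n] cover the subsequence [2 ^ n] met in the averages. *)
Lemma cvgC_exp x (k : nat -> nat) : (forall n, n <= k n)%N -> `|x| < 1 -> cvgC (fun n => x ^+ k n) 0.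
Proof.
move=> nk x1; have [->|x0] := eqVneq x 0.
  apply: (@cvgC_shift _ _ 1); apply: eq_cvgC (cvgC_cst 0) => n.
  by rewrite expr0n; have := nk (n + 1)%N; case: (k _) => //; rewrite addn1.
have x0' : 0 < `|x| by rewrite normr_gt0.
pose d : C := `|x|^-1 - 1; have d0 : 0 < d by rewrite subr_gt0 invf_gt1.
have bern n : 1 + n%:R * d <= (`|x|^-1) ^+ n.
  elim: n => [|n IH]; first by rewrite mul0r addr0.
  rewrite exprS; apply: (@le_trans _ _ ((1 + d) * (1 + n%:R * d))).
    rewrite -subr_ge0; have -> : (1 + d) * (1 + n%:R * d) - (1 + n.+1%:R * d) = n%:R * d ^+ 2.
      by rewrite -[n.+1%:R]natr1; ring.
    by apply: mulr_ge0; rewrite ?ler0n // exprn_ge0 // ltW.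
  by rewrite /d addrC subrK ler_pM2l ?invr_gt0 //.
move=> e e0; have [|N HN] := archimedean_of_complete (x := e^-1 / d).
  by rewrite gtr0_real // divr_gt0 // invr_gt0.
exists N => n Nn; rewrite subr0 normrX -[`|x| ^+ _]invrK invf_ple ?posrE ?invr_gt0 ?exprn_gt0 //.
rewrite -exprVn (le_trans _ (bern _)) // -lerBlDl.
rewrite ler_pdivrMr // in HN; rewrite (le_trans (y := N%:R * d)) //.
  by rewrite (le_trans _ HN) // gerBl.
by rewrite ler_pM2r // ler_nat (leq_trans Nn).
Qed.

Lemma cvgC_half : cvgC (fun n => 2 ^- n : C) 0.
Proof.
apply: eq_cvgC (cvgC_exp (x := 2^-1) (k := id) _ _) => // [n|].
  by rewrite exprVn.
by rewrite normrV ?unitfE ?pnatr_eq0 // normr_nat invf_lt1 ?ltr1n.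
Qed.

(** Nested intervals: those of radius [2 * K * 2 ^- l] about [x l] decrease, and the supremum of
    their left endpoints lies in all of them. *)
Lemma real_geom_limit (x : nat -> C) (K : C) : (forall l : nat, x l \is Num.real) ->
  (forall l : nat, `|x l.+1 - x l| <= K * 2 ^- l) ->
  exists s, forall l : nat, `|x l - s| <= 2 * K * 2 ^- l.
Proof.
move=> xR xK; pose y (l : nat) := x l - 2 * K * 2 ^- l; pose z (l : nat) := x l + 2 * K * 2 ^- l.
have K0 : 0 <= K by have := le_trans (normr_ge0 _) (xK 0); rewrite invr1 mulr1.
have KR (l : nat) : 2 * K * 2 ^- l \is Num.real.
  by rewrite ger0_real // !mulr_ge0 // invr_ge0 exprn_ge0.
have yR l : y l \is Num.real by rewrite rpredB.
have zR l : z l \is Num.real by rewrite rpredD.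
have half (l : nat) : 2 * K * 2 ^- l.+1 = K * 2 ^- l.
  by rewrite exprS invfM; field; rewrite expf_neq0 ?pnatr_eq0.
have twice (l : nat) : 2 * K * 2 ^- l = K * 2 ^- l + K * 2 ^- l.
  by rewrite -mulrA mulr2n mulrDl !mul1r.
have bd (l : nat) : x l - K * 2 ^- l <= x l.+1 <= x l + K * 2 ^- l.
  by rewrite -real_ler_distl ?xK // rpredB.
have incr : {homo y : m n / (m <= n)%N >-> m <= n}.
  apply: homo_leq => // [? ? ? |l]; first exact: le_trans.
  rewrite /y half twice opprD addrA lerD2r; by case/andP: (bd l).
have decr : {homo z : m n / (m <= n)%N >-> n <= m}.
  apply: homo_leq => // [? ? ? h1 h2|l]; first exact: le_trans h2 h1.
  rewrite /z half twice addrA lerD2r; by case/andP: (bd l).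
have yz l : y l <= z l.
  by rewrite lerD2l -subr_ge0 opprK addr_ge0 // !mulr_ge0 // invr_ge0 exprn_ge0.
have yz2 m n : y m <= z n.
  case: (leqP m n) => [mn|/ltnW mn]; first exact: le_trans (incr _ _ mn) (yz n).
  exact: le_trans (yz m) (decr _ _ mn).
have [| | | |s [sR [s1 s2]]] := @real_sup (fun t => exists l : nat, t = y l) (y 0) (z 0).
- by exists 0%N.
- by move=> _ [l ->].
- by [].
- by move=> _ [l ->].
exists s => l; rewrite real_ler_distl ?rpredB //.
have := s1 (y l) (ex_intro _ l erefl); rewrite /y lerBlDr => ->; rewrite andbT lerBlDr.
by apply: (s2 (z l)) => // _ [n ->].
Qed.

Lemma geom_limit (x : nat -> C) (K : C) :
  (forall l, `|x l.+1 - x l| <= K * 2 ^- l) ->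
  exists s, forall l, `|x l - s| <= 4 * K * 2 ^- l.
Proof.
move=> xK.
have [||a Ha] := real_geom_limit (x := fun l => 'Re (x l)) (K := K).
- by move=> l; apply: Creal_Re.
- by move=> l; rewrite -raddfB (le_trans (normC_ge_Re _)).
have [||b Hb] := real_geom_limit (x := fun l => 'Im (x l)) (K := K).
- by move=> l; apply: Creal_Im.
- by move=> l; rewrite -raddfB (le_trans (normC_ge_Im _)).
exists (a + 'i * b) => l; rewrite [x l]Crect opprD addrACA -mulrBr.
rewrite (le_trans (ler_normD _ _)) // normrM normCi mul1r.
have -> : 4 * K * 2 ^- l = 2 * K * 2 ^- l + 2 * K * 2 ^- l by ring.
by rewrite lerD.
Qed.

End Completeness.
End Limits.

(** * Complex differentiability *)

Section Differentiability.
Variable C : numClosedFieldType.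
Implicit Types (f g : C -> C) (x y z : C).

Lemma pos_min2 x y : 0 < x -> 0 < y -> exists z, [/\ 0 < z, z <= x & z <= y].
Proof.
move=> x0 y0; have [xy|yx] := real_leP (gtr0_real x0) (gtr0_real y0).
  by exists x.
by exists y; split=> //; apply: ltW.
Qed.

Lemma eq_cdiff f g x : (forall z, f z = g z) -> cdifferentiable f x -> cdifferentiable g x.
Proof.
move=> fg [d Hd]; exists d => e /Hd[delta [d0 H]]; exists delta; split=> // z /H.
by rewrite !fg.
Qed.

Lemma cdiff_lipschitz f x : cdifferentiable f x ->
  exists K delta : C, [/\ 0 < K, 0 < delta &
    forall z, `|z - x| < delta -> `|f z - f x| <= K * `|z - x|].
Proof.
case=> d Hd; have [delta [d0 H]] := Hd 1 ltr01.
exists (1 + `|d|), delta; split=> // [|z /H]; first by rewrite ltr_pwDl.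
move=> h; rewrite -[f z - f x](subrK (d * (z - x))) (le_trans (ler_normD _ _)) //.
by rewrite mulrDl lerD // normrM.
Qed.

Lemma cdiff_cont f x (e : C) : cdifferentiable f x -> 0 < e ->
  exists2 delta : C, 0 < delta & forall z, `|z - x| < delta -> `|f z - f x| <= e.
Proof.
move=> /cdiff_lipschitz[K [delta [K0 d0 H]]] e0.
have [t [t0 t1 t2]] := pos_min2 d0 (divr_gt0 e0 K0).
exists t => // z zt; rewrite (le_trans (H _ (lt_le_trans zt t1))) //.
by rewrite mulrC -ler_pdivlMr // (le_trans (ltW zt)).
Qed.

Lemma cdiff_cvg f (u : nat -> C) x : cdifferentiable f x -> cvgC u x ->
  cvgC (fun n => f (u n)) (f x).
Proof.
move=> fx ux e e0; have [t t0 H] := cdiff_cont fx e0.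
have [N HN] := ux _ (divr_gt0 t0 (ltr0n _ 2)); exists N => n /HN h.
by apply/H/(le_lt_trans h); rewrite ltr_pdivrMr // ltr_pMr // ltr1n.
Qed.

Lemma cdiff_cst a x : cdifferentiable (fun=> a) x.
Proof.
exists 0 => e e0; exists 1; split=> // z _.
by rewrite subrr mul0r subrr normr0 mulr_ge0 // ltW.
Qed.

Lemma cdiff_id x : cdifferentiable (fun z => z) x.
Proof.
exists 1 => e e0; exists 1; split=> // z _.
by rewrite mul1r subrr normr0 mulr_ge0 // ltW.
Qed.

Lemma cdiffD f g x : cdifferentiable f x -> cdifferentiable g x ->
  cdifferentiable (fun z => f z + g z) x.
Proof.
case=> d Hd [d' Hd']; exists (d + d') => e e0.
have e2 : 0 < e / 2 by rewrite divr_gt0.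
have [t [t0 H]] := Hd _ e2; have [t' [t'0 H']] := Hd' _ e2.
have [s [s0 s1 s2]] := pos_min2 t0 t'0; exists s; split=> // z zs.
have -> : f z + g z - (f x + g x) - (d + d') * (z - x) =
  (f z - f x - d * (z - x)) + (g z - g x - d' * (z - x)) by ring.
rewrite (le_trans (ler_normD _ _)) // [e]splitr mulrDl.
by rewrite lerD ?H ?H' // (lt_le_trans zs).
Qed.

Lemma cdiffM f g x : cdifferentiable f x -> cdifferentiable g x ->
  cdifferentiable (fun z => f z * g z) x.
Proof.
move=> fx gx; have [K [t1 [K0 t10 H1]]] := cdiff_lipschitz fx.
have [K' [t2 [K'0 t20 H2]]] := cdiff_lipschitz gx.
case: fx gx => d Hd [d' Hd']; exists (d * g x + f x * d') => e e0.
have e3 : 0 < e / 3 by rewrite divr_gt0.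
have [t3 [t30 H3]] := Hd _ (divr_gt0 e3 (ltr_pwDl ltr01 (normr_ge0 (g x)))).
have [t4 [t40 H4]] := Hd' _ (divr_gt0 e3 (ltr_pwDl ltr01 (normr_ge0 (f x)))).
have [s1 [s10 s11 s12]] := pos_min2 t10 t20.
have [s2 [s20 s21 s22]] := pos_min2 t30 t40.
have [s3 [s30 s31 s32]] := pos_min2 s10 s20.
have [s [s0 ss3 ss]] := pos_min2 s30 (divr_gt0 e3 (mulr_gt0 K0 K'0)).
exists s; split=> // z zs.
have z3 := lt_le_trans zs ss3.
have z1 := lt_le_trans z3 s31; have z2 := lt_le_trans z3 s32.
have {}H1 := H1 _ (lt_le_trans z1 s11); have {}H2 := H2 _ (lt_le_trans z1 s12).
have {}H3 := H3 _ (lt_le_trans z2 s21); have {}H4 := H4 _ (lt_le_trans z2 s22).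
(* Two first-order errors and one product of increments, each allotted [e / 3]. *)
have -> : f z * g z - f x * g x - (d * g x + f x * d') * (z - x) =
  (f z - f x - d * (z - x)) * g x + f x * (g z - g x - d' * (z - x))
   + (f z - f x) * (g z - g x) by ring.
have -> : e = e / 3 + e / 3 + e / 3 by field.
have frac (a b : C) : 0 <= b -> 0 <= a -> a / (1 + b) * b <= a.
  by move=> b0 a0; rewrite mulrAC ler_pdivrMr ?ltr_pwDl // mulrDr mulr1 lerDr.
rewrite (le_trans (ler_normD _ _)) // [leRHS]mulrDl lerD //; last first.
  rewrite normrM (le_trans (ler_pM _ _ H1 H2)) // mulrACA mulrA ler_wpM2r //.
  by rewrite mulrC -ler_pdivlMr ?mulr_gt0 // (le_trans (ltW zs)).
rewrite (le_trans (ler_normD _ _)) // [leRHS]mulrDl lerD // normrM.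
  rewrite (le_trans (ler_wpM2r (normr_ge0 _) H3)) // mulrAC ler_wpM2r //.
  by apply: frac => //; apply: ltW.
rewrite mulrC (le_trans (ler_wpM2r (normr_ge0 _) H4)) // mulrAC ler_wpM2r //.
by apply: frac => //; apply: ltW.
Qed.

Lemma cdiffV f x : f x != 0 -> cdifferentiable f x ->
  cdifferentiable (fun z => (f z)^-1) x.
Proof.
move=> f0 fx; have [K [t1 [K0 t10 H1]]] := cdiff_lipschitz fx.
have nf0 : 0 < `|f x| by rewrite normr_gt0.
have [t2 t20 H2] := cdiff_cont fx (divr_gt0 nf0 (ltr0n _ 2)).
case: fx => d Hd; exists (- d / f x ^+ 2) => e e0.
(* Once [|f z| >= |f x| / 2], the denominator [f z * f x ^+ 2] has modulus at least [2 * m], which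
   leaves [e * m * |z - x|] for each of the two terms of the numerator. *)
pose m := `|f x| ^+ 3 / 4; have m0 : 0 < m by rewrite divr_gt0 ?exprn_gt0.
have em : 0 < e * m by rewrite mulr_gt0.
have [t3 [t30 H3]] := Hd _ (divr_gt0 em nf0).
have D1 : 0 < (1 + `|d|) * K by rewrite mulr_gt0 // ltr_pwDl.
have [s1 [s10 s11 s12]] := pos_min2 t10 t20.
have [s2 [s20 s21 s22]] := pos_min2 s10 t30.
have [s [s0 ss2 ss]] := pos_min2 s20 (divr_gt0 em D1).
exists s; split=> // z zs.
have z2 := lt_le_trans zs ss2; have z1 := lt_le_trans z2 s21.
have {}H1 := H1 _ (lt_le_trans z1 s11); have {}H2 := H2 _ (lt_le_trans z1 s12).
have {}H3 := H3 _ (lt_le_trans z2 s22).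
have fz : `|f x| / 2 <= `|f z|.
  have : `|f x| <= `|f z| + `|f x| / 2.
    rewrite -[f x](subKr (f z)) (le_trans (ler_normB _ _)) // lerD2l.
    by rewrite subKr.
  rewrite -lerBlDr; apply: le_trans; have -> : `|f x| - `|f x| / 2 = `|f x| / 2 by field.
  by [].
have fz0 : f z != 0.
  by rewrite -normr_gt0 (lt_le_trans _ fz) // divr_gt0.
have -> : (f z)^-1 - (f x)^-1 - - d / f x ^+ 2 * (z - x) =
  (d * (z - x) * (f z - f x) - f x * (f z - f x - d * (z - x))) / (f z * f x ^+ 2).
  by field; rewrite fz0 f0.
rewrite normrM normfV ler_pdivrMr; last by rewrite normr_gt0 mulf_neq0 // expf_neq0.
apply: (@le_trans _ _ (e * `|z - x| * (2 * m))); last first.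
  rewrite ler_wpM2l ?mulr_ge0 ?(ltW e0) // normrM normrX.
  have -> : 2 * m = `|f x| / 2 * `|f x| ^+ 2 by rewrite /m; field.
  by rewrite ler_wpM2r // exprn_ge0.
have -> : e * `|z - x| * (2 * m) = e * m * `|z - x| + e * m * `|z - x| by ring.
rewrite (le_trans (ler_normB _ _)) // lerD //.
  rewrite !normrM (le_trans (ler_wpM2l _ H1)) ?mulr_ge0 //.
  rewrite mulrA ler_wpM2r // mulrAC.
  apply: (@le_trans _ _ ((1 + `|d|) * K * `|z - x|)).
    by rewrite !ler_wpM2r ?(ltW K0) // lerDr.
  by rewrite mulrC -ler_pdivlMr // (le_trans (ltW zs)).
rewrite normrM (le_trans (ler_wpM2l _ H3)) //.
by rewrite mulrA [_ * (_ / _)]mulrC divfK // gt_eqF.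
Qed.

Lemma cdiffN f x : cdifferentiable f x -> cdifferentiable (fun z => - f z) x.
Proof.
move=> fx; apply: eq_cdiff (cdiffM (cdiff_cst (-1) x) fx) => z; exact: mulN1r.
Qed.

Lemma cdiffB f g x : cdifferentiable f x -> cdifferentiable g x ->
  cdifferentiable (fun z => f z - g z) x.
Proof. by move=> fx gx; apply: cdiffD => //; apply: cdiffN. Qed.

Lemma cdiff_sum (I : Type) (r : seq I) (P : pred I) (f : I -> C -> C) x :
  (forall i, cdifferentiable (f i) x) ->
  cdifferentiable (fun z => \sum_(i <- r | P i) f i z) x.
Proof.
move=> fx; elim: r => [|i r IH].
  by apply: eq_cdiff (cdiff_cst 0 x) => z; rewrite big_nil.
have [Pi|Pi] := boolP (P i).
  by apply: eq_cdiff (cdiffD (fx i) IH) => z; rewrite big_cons Pi.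
by apply: eq_cdiff IH => z; rewrite big_cons (negPf Pi).
Qed.

Lemma cdiff_prod (I : Type) (r : seq I) (P : pred I) (f : I -> C -> C) x :
  (forall i, cdifferentiable (f i) x) ->
  cdifferentiable (fun z => \prod_(i <- r | P i) f i z) x.
Proof.
move=> fx; elim: r => [|i r IH].
  by apply: eq_cdiff (cdiff_cst 1 x) => z; rewrite big_nil.
have [Pi|Pi] := boolP (P i).
  by apply: eq_cdiff (cdiffM (fx i) IH) => z; rewrite big_cons Pi.
by apply: eq_cdiff IH => z; rewrite big_cons (negPf Pi).
Qed.

Lemma cdiff_det n (A : C -> 'M[C]_n) x :
  (forall i j, cdifferentiable (fun z => A z i j) x) ->
  cdifferentiable (fun z => \det (A z)) x.
Proof.
move=> Ax; apply: cdiff_sum => s; apply: cdiffM; first exact: cdiff_cst.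
by apply: cdiff_prod => i.
Qed.

End Differentiability.

(** * Dyadic roots of unity *)

Section DyadicRoots.
Variable C : numClosedFieldType.

(** The root in the right half-plane is the one of smaller argument, so that iterates starting from
    -1 approach 1. *)
Definition Re_sqrt (z : C) : C := if 0 <= 'Re (sqrtC z) then sqrtC z else - sqrtC z.

Lemma Re_sqrtK z : Re_sqrt z ^+ 2 = z.
Proof. by rewrite /Re_sqrt; case: ifP; rewrite ?sqrrN sqrtCK. Qed.

Lemma Re_sqrt_ge0 z : 0 <= 'Re (Re_sqrt z).
Proof.
rewrite /Re_sqrt; case: ifP => // /negbT; rewrite raddfN oppr_ge0 /= -real_ltNge ?real0 ?Creal_Re //.
exact: ltW.
Qed.

(* [exp (2 i pi / 2 ^ l)], up to the choice of [i]. *)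
Definition dyroot (l : nat) : C := if l is k.+1 then iter k Re_sqrt (-1) else 1.

Lemma dyrootS l : dyroot l.+1 ^+ 2 = dyroot l.
Proof. by case: l => [|l]; rewrite ?sqrrN ?expr1n //= Re_sqrtK. Qed.

Lemma dyroot_neg l : dyroot l.+1 ^+ (2 ^ l) = -1.
Proof. by elim: l => // l IH; rewrite expnS exprM dyrootS IH. Qed.

Lemma dyroot_exp l : dyroot l ^+ (2 ^ l) = 1.
Proof. by case: l => // l; rewrite expnSr exprM dyroot_neg sqrrN expr1n. Qed.

Lemma norm_dyroot l : `|dyroot l| = 1.
Proof.
apply/eqP; rewrite -(@pexpr_eq1 _ _ (2 ^ l)) // ?expn_gt0 //.
by rewrite -normrX dyroot_exp normr1.
Qed.

Lemma dyroot_neq0 l : dyroot l != 0.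
Proof. by rewrite -normr_gt0 norm_dyroot. Qed.

(* [|w - 1| / |w + 1|] is the tangent of half the argument of [w], and
   [tan (t / 2) <= tan t / 2]. *)
Lemma dyroot_tan l : `|dyroot l.+2 - 1| * 2 ^+ l <= `|dyroot l.+2 + 1|.
Proof.
elim: l => [|l IH].
  have -> : dyroot 2 - 1 = dyroot 2 * (dyroot 2 + 1).
    by rewrite mulrDr -expr2 (dyrootS 1) mulr1 addrC.
  by rewrite normrM norm_dyroot mul1r expr0 mulr1.
set u := dyroot l.+3; have u2 : u ^+ 2 = dyroot l.+2 by apply: dyrootS.
have un : `|u| = 1 by apply: norm_dyroot.
have uu : u * u^* = 1 by rewrite -normCK un expr1n.
have Ru : 0 <= 'Re u by apply: Re_sqrt_ge0.
have Ru1 : 'Re u <= 1 by rewrite -un; exact: (leif_Re_Creal u).1.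
have u2p : `|u ^+ 2 + 1| = 2 * 'Re u.
  have -> : u ^+ 2 + 1 = u * (2 * 'Re u) by rewrite ReE -[1 in LHS]uu; field.
  by rewrite normrM un mul1r ger0_norm // mulr_ge0.
have u1p : `|u + 1| ^+ 2 = 2 + 2 * 'Re u.
  rewrite normCK rmorphD rmorph1 mulrDl !mulrDr uu !mulr1 mul1r ReE.
  by field.
have up0 : 0 < `|u + 1|.
  rewrite normr_gt0; apply/eqP => h; move/eqP: u1p.
  by rewrite h normr0 expr0n eq_sym gt_eqF // ltr_pwDl // mulr_ge0.
(* Multiplied by [|u + 1|], the left side is [2 ^+ l.+1] times [|u ^+ 2 - 1|]; by induction it is at
   most [4 * 'Re u], hence at most [2 + 2 * 'Re u] as ['Re u <= 1]. *)
rewrite -(ler_pM2r up0) -expr2 u1p.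
have := IH; rewrite -u2 u2p => {}IH.
apply: (@le_trans _ _ (2 * (2 * 'Re u))).
  apply: le_trans (ler_wpM2l _ IH) => //.
  by rewrite subr_sqr_1 normrM exprS mulrAC mulrA [_ * 2]mulrC !mulrA.
have -> : 2 + 2 * 'Re u = 2 * (1 + 'Re u) by ring.
by rewrite ler_pM2l // mulr2n mulrDl !mul1r lerD2r.
Qed.

Lemma dyroot_sub1_le l : `|dyroot l - 1| <= 8 * 2 ^- l.
Proof.
case: l => [|[|l]].
- by rewrite subrr normr0 mulr_ge0 // invr_ge0.
- rewrite -opprD normrN ger0_norm ?addr_ge0 //.
  have -> : 8 * 2^-1 = 1 + 1 + 2 :> C by field.
  by rewrite lerDl.
have -> : 8 * 2 ^- l.+2 = (1 + 1) * 2 ^- l :> C.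
  by rewrite !exprS; field; rewrite expf_neq0 ?pnatr_eq0.
rewrite ler_pdivlMr ?exprn_gt0 // (le_trans (dyroot_tan l)) //.
by rewrite (le_trans (ler_normD _ _)) // norm_dyroot normr1.
Qed.

Lemma norm_exp_sub1_le (x : C) n : `|x| = 1 -> `|x ^+ n - 1| <= n%:R * `|x - 1|.
Proof.
move=> x1; elim: n => [|n IH]; first by rewrite subrr normr0 mul0r.
have -> : x ^+ n.+1 - 1 = x * (x ^+ n - 1) + (x - 1) by rewrite exprS; ring.
rewrite (le_trans (ler_normD _ _)) // normrM x1 mul1r -natr1 mulrDl mul1r.
by rewrite lerD2r.
Qed.

(** [|w - w^-1| = |w ^+ 2 - 1|], and [2 ^ l] steps of [w ^+ 2] lead from 1 to -1, at distance 2.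
    This keeps the factor between contour sums and averages away from 0. *)
Lemma dyroot_subV_ge l : 8 * 2 ^- l.+2 <= `|dyroot l.+2 - (dyroot l.+2)^-1|.
Proof.
set w := dyroot l.+2; have w1 : `|w| = 1 by apply: norm_dyroot.
have -> : `|w - w^-1| = `|dyroot l.+1 - 1|.
  have -> : w - w^-1 = w^-1 * (w ^+ 2 - 1) by field; apply: dyroot_neq0.
  by rewrite normrM normfV w1 invr1 mul1r dyrootS.
have := norm_exp_sub1_le (2 ^ l) (norm_dyroot l.+1).
rewrite dyroot_neg -opprD normrN ger0_norm ?addr_ge0 // natrX => h.
have -> : 8 * 2 ^- l.+2 = (1 + 1) * 2 ^- l :> C.
  by rewrite !exprS; field; rewrite expf_neq0 ?pnatr_eq0.
by rewrite ler_pdivrMr ?exprn_gt0 // mulrC.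
Qed.

End DyadicRoots.

(** * Goursat's lemma for the trapezoid rule *)

Lemma dependent_choice (T : Type) (G : nat -> T -> Prop) (R : nat -> T -> T -> Prop) x0 :
  G 0%N x0 -> (forall n x, G n x -> exists y, R n x y /\ G n.+1 y) ->
  exists u, forall n, G n (u n) /\ R n (u n) (u n.+1).
Proof.
move=> G0 GR; pose f n x := epsilon (inhabits x0) (fun y => R n x y /\ G n.+1 y).
pose u := fix u n := if n is k.+1 then f k (u k) else x0.
have Gu n : G n (u n).
  by elim: n => //= n /GR h; case: (epsilon_spec (inhabits x0) _ h).
by exists u => n; split=> //; case: (epsilon_spec (inhabits x0) _ (GR _ _ (Gu n))).
Qed.

Section Goursat.
Variable C : numClosedFieldType.
Hypothesis Cc : real_complete C.

Definition trap (g : C -> C) (x y : C) : C := (y - x) * (g x + g y) / 2.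

Lemma trap_le g x y (t : C) : `|g x| <= t -> `|g y| <= t -> `|trap g x y| <= `|y - x| * t.
Proof.
move=> gx gy; rewrite !normrM -mulrA ler_wpM2l // normfV normr_nat ler_pdivrMr //.
by rewrite (le_trans (ler_normD _ _)) // mulr_natr mulr2n lerD.
Qed.

(* [P l a b] is the node [(a, b)] of the [l]-th dyadic subdivision of a parametrized square. *)
Variables (P : nat -> nat -> nat -> C) (L : C).
Hypothesis P_double : forall l a b, P l.+1 a.*2 b.*2 = P l a b.
Hypothesis P_lipl : forall l a b, `|P l a.+1 b - P l a b| <= L * 2 ^- l.
Hypothesis P_lipr : forall l a b, `|P l a b.+1 - P l a b| <= L * 2 ^- l.

Lemma lip_ge0 : 0 <= L.
Proof. by have := le_trans (normr_ge0 _) (P_lipl 0 0 0); rewrite invr1 mulr1. Qed.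

Lemma P_pow2 l a b e : P (l + e) (a * 2 ^ e) (b * 2 ^ e) = P l a b.
Proof.
elim: e => [|e IH]; first by rewrite addn0 !muln1.
by rewrite addnS expnS !(mulnCA _ 2%N) !mul2n P_double.
Qed.

Lemma P_dist m a b i j : `|P m (a + i) (b + j) - P m a b| <= (i + j)%:R * (L * 2 ^- m).
Proof.
elim: i => [|i IH]; last first.
  rewrite -[P m (a + i.+1) _](subrK (P m (a + i) (b + j))) -addrA.
  rewrite (le_trans (ler_normD _ _)) // addSn -natr1 mulrDl mul1r [leRHS]addrC lerD //.
  by rewrite addnS P_lipl.
rewrite addn0; elim: j => [|j IH]; first by rewrite addn0 subrr normr0 mul0r.
rewrite -[P m a (b + j.+1)](subrK (P m a (b + j))) -addrA.
rewrite (le_trans (ler_normD _ _)) // [in leRHS]addnS -natr1 mulrDl mul1r [leRHS]addrC lerD //.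
by rewrite addnS P_lipr.
Qed.

(** The trapezoid sum around the closed boundary of one cell; sides traversed backwards enter with a
    minus sign. *)
Definition cell g m i j : C :=
  trap g (P m i j) (P m i.+1 j) + trap g (P m i.+1 j) (P m i.+1 j.+1)
  - trap g (P m i j.+1) (P m i.+1 j.+1) - trap g (P m i j) (P m i j.+1).

(* The cell [(a, b)] of level [l], measured on the mesh of level [l + e]. *)
Definition block g l a b e : C :=
  \sum_(i < 2 ^ e) \sum_(j < 2 ^ e) cell g (l + e) (a * 2 ^ e + i) (b * 2 ^ e + j).

Lemma block_split g l a b e : block g l a b e.+1 =
  block g l.+1 a.*2 b.*2 e + block g l.+1 a.*2 b.*2.+1 e
  + (block g l.+1 a.*2.+1 b.*2 e + block g l.+1 a.*2.+1 b.*2.+1 e).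
Proof.
have dbl (F : nat -> C) : \sum_(i < 2 ^ e.+1) F i =
    \sum_(i < 2 ^ e) F i + \sum_(i < 2 ^ e) F (2 ^ e + i)%N.
  by rewrite expnS mul2n -addnn big_split_ord.
have even c : (c * 2 ^ e.+1 = c.*2 * 2 ^ e)%N by rewrite expnS mulnA muln2.
have odd c i : (c * 2 ^ e.+1 + (2 ^ e + i) = c.*2.+1 * 2 ^ e + i)%N.
  by rewrite even mulSn; lia.
rewrite /block (dbl (fun i => \sum_(j < 2 ^ e.+1) cell g (l + e.+1) (a * 2 ^ e.+1 + i) (b * 2 ^ e.+1 + j))).
congr (_ + _); rewrite -big_split; apply: eq_bigr => i _ /=.
  rewrite (dbl (fun j => cell g (l + e.+1) (a * 2 ^ e.+1 + i) (b * 2 ^ e.+1 + j))).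
  by congr (_ + _); apply: eq_bigr => j _; rewrite ?odd !even addnS.
rewrite (dbl (fun j => cell g (l + e.+1) (a * 2 ^ e.+1 + (2 ^ e + i)) (b * 2 ^ e.+1 + j))).
by congr (_ + _); apply: eq_bigr => j _; rewrite !odd ?even addnS.
Qed.

(** Each interior edge is traversed once in either direction by its two neighbouring cells, so the
    sums telescope to the outer boundary. *)
Lemma block_boundary g l a b e :
  let m := (l + e)%N in let A := (a * 2 ^ e)%N in let B := (b * 2 ^ e)%N in
  block g l a b e =
    \sum_(i < 2 ^ e) (trap g (P m (A + i) B) (P m (A + i).+1 B)
         - trap g (P m (A + i) (B + 2 ^ e)) (P m (A + i).+1 (B + 2 ^ e)))
    + \sum_(j < 2 ^ e) (trap g (P m (A + 2 ^ e) (B + j)) (P m (A + 2 ^ e) (B + j).+1)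
         - trap g (P m A (B + j)) (P m A (B + j).+1)).
Proof.
move=> m A B; rewrite /block -/m -/A -/B.
have tele (F : nat -> C) n : \sum_(i < n) (F i.+1 - F i) = F n - F 0%N.
  by elim: n => [|n IH]; rewrite ?big_ord0 ?subrr // big_ord_recr /= IH addrC subrKA.
pose H i j := trap g (P m (A + i) (B + j)) (P m (A + i).+1 (B + j)).
pose V i j := trap g (P m (A + i) (B + j)) (P m (A + i) (B + j).+1).
transitivity (\sum_(i < 2 ^ e) (H i 0%N - H i (2 ^ e)%N)
    + \sum_(j < 2 ^ e) (V (2 ^ e)%N j - V 0%N j)); last first.
  by rewrite /H /V !addn0.
have -> : \sum_(j < 2 ^ e) (V (2 ^ e)%N j - V 0%N j) =
    \sum_(i < 2 ^ e) \sum_(j < 2 ^ e) (V i.+1 j - V i j).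
  by rewrite exchange_big; apply: eq_bigr => j _; rewrite (tele (V^~ j)).
rewrite -big_split; apply: eq_bigr => i _ /=.
rewrite -(opprB (H _ _)) -tele -sumrN -big_split; apply: eq_bigr => j _ /=.
by rewrite /cell /H /V !addnS; ring.
Qed.

(** On affine functions the trapezoid rule is a difference of values of a quadratic primitive, so it
    cancels around every cell. *)
Lemma block_subl g c d l a b e :
  block (fun z => g z - (c + d * z)) l a b e = block g l a b e.
Proof.
apply: eq_bigr => i _; apply: eq_bigr => j _; rewrite /cell /trap.
by field.
Qed.

(** The boundary has [4 * 2 ^ e] edges of length at most [L * 2 ^- (l + e)], so its length is
    bounded independently of the mesh. *)
Lemma block_le g l a b e t :
  (forall i j, (i <= 2 ^ e)%N -> (j <= 2 ^ e)%N ->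
     `|g (P (l + e) (a * 2 ^ e + i) (b * 2 ^ e + j))| <= t) ->
  `|block g l a b e| <= 4 * (L * 2 ^- l) * t.
Proof.
move=> gt; set m := (l + e)%N; set A := (a * 2 ^ e)%N; set B := (b * 2 ^ e)%N.
have t0 : 0 <= t by apply: le_trans (gt 0 0 _ _)%N.
pose s := L * 2 ^- m * t.
have H i j : (i < 2 ^ e)%N -> (j <= 2 ^ e)%N ->
    `|trap g (P m (A + i) (B + j)) (P m (A + i).+1 (B + j))| <= s.
  move=> ie je; rewrite (le_trans (trap_le (t := t) _ _)) ?gt ?(ltnW ie) //.
    by rewrite -addnS gt.
  by rewrite ler_wpM2r.
have V i j : (i <= 2 ^ e)%N -> (j < 2 ^ e)%N ->
    `|trap g (P m (A + i) (B + j)) (P m (A + i) (B + j).+1)| <= s.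
  move=> ie je; rewrite (le_trans (trap_le (t := t) _ _)) ?gt ?(ltnW je) //.
    by rewrite -addnS gt.
  by rewrite ler_wpM2r.
have -> : 4 * (L * 2 ^- l) * t = \sum_(i < 2 ^ e) (s + s) + \sum_(i < 2 ^ e) (s + s).
  rewrite !sumr_const card_ord -[(s + s) *+ _]mulr_natr natrX /s /m exprD; field.
  by rewrite !expf_neq0 ?pnatr_eq0.
rewrite block_boundary (le_trans (ler_normD _ _)) // lerD //.
  rewrite (le_trans (ler_norm_sum _ _ _)) // ler_sum // => i _.
  rewrite (le_trans (ler_normB _ _)) // lerD ?H //.
  by have := H i 0%N (ltn_ord i) isT; rewrite addn0.
rewrite (le_trans (ler_norm_sum _ _ _)) // ler_sum // => j _.
rewrite (le_trans (ler_normB _ _)) // lerD ?V //.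
by have := V 0%N j isT (ltn_ord j); rewrite addn0.
Qed.

(** The bound scales like the area of the cell, so four fine quarters make a fine cell. Large [e]
    stands for the limit of the trapezoid sums, the contour integral. *)
Definition fine g (eps : C) l (ab : nat * nat) :=
  exists e0, forall e, (e0 <= e)%N -> `|block g l ab.1 ab.2 e| <= eps * (2 ^- l) ^+ 2.

Lemma fine_split g eps l ab : ~ fine g eps l ab ->
  exists d d' : bool, ~ fine g eps l.+1 (ab.1.*2 + d, ab.2.*2 + d')%N.
Proof.
move=> nf; apply: NNPP => h; apply: nf.
have f d d' : fine g eps l.+1 (ab.1.*2 + nat_of_bool d, ab.2.*2 + nat_of_bool d')%N.
  by apply: NNPP => ?; apply: h; exists d, d'.
have [e00 H00] := f false false; have [e01 H01] := f false true.
have [e10 H10] := f true false; have [e11 H11] := f true true.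
exists (maxn (maxn e00 e01) (maxn e10 e11)).+1 => -[//|e].
rewrite ltnS !geq_max => /andP[/andP[h0 h1] /andP[h2 h3]].
rewrite block_split; have -> : eps * (2 ^- l) ^+ 2 =
  eps * (2 ^- l.+1) ^+ 2 + eps * (2 ^- l.+1) ^+ 2 + (eps * (2 ^- l.+1) ^+ 2 + eps * (2 ^- l.+1) ^+ 2).
  by rewrite [2 ^+ l.+1]exprS; field; rewrite expf_neq0 ?pnatr_eq0.
have := H00 _ h0; have := H01 _ h1; have := H10 _ h2; have := H11 _ h3.
rewrite /= !addn0 !addn1 => b11 b10 b01 b00.
by do 2! [rewrite (le_trans (ler_normD _ _)) // lerD //]; rewrite (le_trans (ler_normD _ _)) // lerD.
Qed.

(** Bisection: a cell that is not fine contains ever smaller ones, shrinking to a point [z]. There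
    the affine part of [g] contributes nothing, and the remainder times the boundary length is of
    the order of the area. *)
Theorem goursat g (eps : C) : 0 < eps ->
  (forall z, (forall t : C, 0 < t -> exists l a b, `|P l a b - z| <= t) -> cdifferentiable g z) ->
  fine g eps 0 (0, 0)%N.
Proof.
move=> eps0 gd; apply: NNPP => nf.
have [] := @dependent_choice (nat * nat)%type (fun l ab => ~ fine g eps l ab)
   (fun _ ab cd => exists d d' : bool, cd = (ab.1.*2 + d, ab.2.*2 + d')%N) (0, 0)%N nf.
  move=> l ab /fine_split[d [d' H]].
  by exists (ab.1.*2 + d, ab.2.*2 + d')%N; split=> //; exists d, d'.
move=> u Hu; pose x l := P l (u l).1 (u l).2.
have L0 := lip_ge0.
have [l|z Hz] := geom_limit Cc (x := x) (K := L).
  have [_ [d [d' E]]] := Hu l; rewrite /x E -(P_double l) /=.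
  rewrite (le_trans (P_dist _ _ _ _ _)) //.
  have -> : L * 2 ^- l = 2 * (L * 2 ^- l.+1).
    by rewrite exprS; field; rewrite expf_neq0 ?pnatr_eq0.
  rewrite ler_wpM2r ?mulr_ge0 ?invr_ge0 ?exprn_ge0 // ler_nat.
  by case: (d); case: (d').
(* [2 * L] accounts for the extent of the cell, [4 * L] for the distance of its corner from the
   limit. *)
have near l e i j : (i <= 2 ^ e)%N -> (j <= 2 ^ e)%N ->
    `|P (l + e) ((u l).1 * 2 ^ e + i) ((u l).2 * 2 ^ e + j) - z| <= 6 * L * 2 ^- l.
  move=> ie je; rewrite -[P _ _ _](subrK (x l)) -addrA (le_trans (ler_normD _ _)) //.
  have -> : 6 * L * 2 ^- l = 2 * (L * 2 ^- l) + 4 * L * 2 ^- l by ring.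
  rewrite lerD // /x -(P_pow2 l _ _ e) (le_trans (P_dist _ _ _ _ _)) //.
  have -> : 2 * (L * 2 ^- l) = (2 ^ e + 2 ^ e)%:R * (L * 2 ^- (l + e)).
    by rewrite natrD natrX exprD; field; rewrite !expf_neq0 ?pnatr_eq0.
  by rewrite ler_wpM2r ?mulr_ge0 ?invr_ge0 ?exprn_ge0 // ler_nat leq_add.
have near0 t : 0 < t -> exists l, 6 * L * 2 ^- l <= t.
  move=> t0; have [N HN] := cvgCM (6 * L) (cvgC_half Cc) t0.
  exists N; have := HN N (leqnn N).
  by rewrite mulr0 subr0 ger0_norm // !mulr_ge0 // invr_ge0 exprn_ge0.
have [t t0|d Hd] := gd z.
  have [l lt] := near0 t t0; exists (l + 0)%N, ((u l).1 * 2 ^ 0 + 0)%N, ((u l).2 * 2 ^ 0 + 0)%N.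
  by rewrite (le_trans (near l 0 0 0 _ _)%N).
(* 24 is the 4 of the boundary length times the 6 of [near]; adding 1 avoids a zero denominator when
   [L = 0]. *)
have e'0 : 0 < eps / (24 * L ^+ 2 + 1).
  by rewrite divr_gt0 // ltr_wpDl // mulr_ge0 // exprn_ge0.
have [delta [delta0 H]] := Hd _ e'0.
have [l ld] := near0 _ (divr_gt0 delta0 (ltr0n _ 2)).
have [] := Hu l; case; exists 0%N => e _.
rewrite -(block_subl g (g z - d * z) d).
rewrite (le_trans (block_le (t := eps / (24 * L ^+ 2 + 1) * (6 * L * 2 ^- l)) _)) //.
  move=> i j ie je; have nij := near l e i j ie je.
  set w := P _ _ _ in nij *.
  have -> : g w - (g z - d * z + d * w) = g w - g z - d * (w - z) by ring.
  rewrite (le_trans (H _ _)) ?ler_wpM2l ?(ltW e'0) //.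
  by rewrite (le_lt_trans nij) // (le_lt_trans ld) // ltr_pdivrMr // ltr_pMr // ltr1n.
have D0 : 0 < 24 * L ^+ 2 + 1 by rewrite ltr_wpDl // mulr_ge0 // exprn_ge0.
have -> : 4 * (L * 2 ^- l) * (eps / (24 * L ^+ 2 + 1) * (6 * L * 2 ^- l)) =
  eps * (2 ^- l) ^+ 2 * ((24 * L ^+ 2) / (24 * L ^+ 2 + 1)).
  by field; rewrite gt_eqF //= expf_neq0 ?pnatr_eq0.
rewrite ger_pMr ?ler_pdivrMr ?mul1r ?lerDl //.
by apply: mulr_gt0; rewrite // exprn_gt0 // invr_gt0 exprn_gt0.
Qed.

End Goursat.

(** * Cauchy's formula for averages over roots of unity *)

Section CauchyFormula.
Variable C : numClosedFieldType.
Hypothesis Cc : real_complete C.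
Variables (r : C).
Hypothesis r0 : 0 < r.

Definition avg (e : nat) (f : C -> C) : C :=
  2 ^- e * \sum_(j < 2 ^ e) f (r * dyroot C e ^+ j).

Lemma norm_circ e j : `|r * dyroot C e ^+ j| = r.
Proof. by rewrite normrM normrX norm_dyroot expr1n mulr1 gtr0_norm. Qed.

Lemma eq_avg e f g : (forall z, `|z| = r -> f z = g z) -> avg e f = avg e g.
Proof.
by move=> fg; congr (_ * _); apply: eq_bigr => j _; apply/fg/norm_circ.
Qed.

Lemma avgD e f g : avg e (fun z => f z + g z) = avg e f + avg e g.
Proof. by rewrite /avg big_split mulrDr. Qed.

Lemma avgM e a f : avg e (fun z => a * f z) = a * avg e f.
Proof. by rewrite /avg -mulr_sumr mulrCA. Qed.

Lemma avgB e f g : avg e (fun z => f z - g z) = avg e f - avg e g.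
Proof. by rewrite /avg sumrB mulrBr. Qed.

Lemma avg_sum (I : Type) (s : seq I) e (f : I -> C -> C) :
  avg e (fun z => \sum_(i <- s) f i z) = \sum_(i <- s) avg e (f i).
Proof. by rewrite /avg exchange_big mulr_sumr. Qed.

Lemma avg_conj e f : avg e (fun z => (f z)^*) = (avg e f)^*.
Proof.
rewrite /avg rmorphM fmorphV rmorphXn rmorph_nat; congr (_ * _).
by rewrite rmorph_sum.
Qed.

Lemma avg_ge0 e f : (forall z, `|z| = r -> 0 <= f z) -> 0 <= avg e f.
Proof.
move=> f0; rewrite mulr_ge0 ?invr_ge0 ?exprn_ge0 // sumr_ge0 // => j _.
exact/f0/norm_circ.
Qed.

Lemma avg_le e f (t : C) : (forall z, `|z| = r -> `|f z| <= t) -> `|avg e f| <= t.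
Proof.
move=> ft; rewrite normrM normfV normrX normr_nat mulrC ler_pdivrMr ?exprn_gt0 //.
rewrite (le_trans (ler_norm_sum _ _ _)) //.
have -> : t * 2 ^+ e = \sum_(j < 2 ^ e) t.
  by rewrite sumr_const card_ord -[t *+ _]mulr_natr natrX.
by apply: ler_sum => j _; apply/ft/norm_circ.
Qed.

Variable zeta : C.
Hypothesis zr : `|zeta| < r.

Let rho_gt0 : 0 < r - `|zeta|. Proof. by rewrite subr_gt0. Qed.

Lemma circ_dist (u : C) : `|u| = r -> r - `|zeta| <= `|u - zeta|.
Proof. by move=> ur; rewrite lerBlDr -{1}ur -[u in leLHS](subrK zeta) ler_normD. Qed.

Lemma circ_neq (u : C) : `|u| = r -> u - zeta != 0.
Proof. by move=> /circ_dist h; rewrite -normr_gt0 (lt_le_trans _ h). Qed.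

Lemma sum_cyclic (f : nat -> C) n : f n = f 0%N ->
  \sum_(j < n) f j.+1 = \sum_(j < n) f j.
Proof.
move=> fn; apply/eqP; rewrite -subr_eq0 -sumrB.
suff -> : \sum_(j < n) (f j.+1 - f j) = f n - f 0%N by rewrite fn subrr.
by elim: n {fn} => [|n IH]; rewrite ?big_ord0 ?subrr // big_ord_recr /= IH addrC subrKA.
Qed.

(** Edges and distances to [zeta] both scale by [s], so [s] survives only inside [F]. After a cyclic
    shift each vertex receives [(w - 1) / 2] from one edge and [(1 - w^-1) / 2] from the other. *)
Lemma trap_circle (F : C -> C) (s : C) e (N := (2 ^ e)%N) (w := dyroot C e)
  (p := fun u : C => zeta + s * (u - zeta)) :
  s != 0 ->
  \sum_(j < N) trap (fun z => (F z - F zeta) / (z - zeta)) (p (r * w ^+ j)) (p (r * w ^+ j.+1))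
  = (w - w^-1) / 2 * \sum_(j < N) (F (p (r * w ^+ j)) - F zeta) * (r * w ^+ j / (r * w ^+ j - zeta)).
Proof.
move=> s0; pose G j := (F (p (r * w ^+ j)) - F zeta) / (r * w ^+ j - zeta).
have w0 : w != 0 := dyroot_neq0 C e.
have step j : trap (fun z => (F z - F zeta) / (z - zeta)) (p (r * w ^+ j)) (p (r * w ^+ j.+1))
   = (w - 1) / 2 * (r * w ^+ j * G j) + (1 - w^-1) / 2 * (r * w ^+ j.+1 * G j.+1).
  have h u : p u - zeta = s * (u - zeta) by rewrite /p; ring.
  rewrite /trap !h /G exprS; set u := r * w ^+ j.
  have -> : r * (w * w ^+ j) = w * u by rewrite /u; ring.
  have n1 : u - zeta != 0 by apply/circ_neq/norm_circ.
  have n2 : w * u - zeta != 0.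
    by rewrite /u mulrCA -exprS; apply/circ_neq/norm_circ.
  have -> : p (w * u) - p u = s * (w - 1) * u by rewrite /p; ring.
  by field; rewrite w0 n1 n2 s0.
under eq_bigr do rewrite step.
rewrite big_split -!mulr_sumr /=.
rewrite (@sum_cyclic (fun j => r * w ^+ j * G j)); last first.
  by rewrite /G /N dyroot_exp expr0.
rewrite -mulrDl; congr (_ * _); first by field.
by apply: eq_bigr => j _; rewrite /G; ring.
Qed.

(** * Shrinking the circle towards the point [zeta] *)

Section Homotopy.
Variable s0 : C.
Hypotheses (s0_gt0 : 0 < s0) (s0_le1 : s0 <= 1).

(* [minn] makes the Lipschitz bounds hold for all [a], although only [a <= 2 ^ l] is used. *)
Definition hscale l a : C := s0 + (1 - s0) * ((minn a (2 ^ l))%:R * 2 ^- l).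

Definition homotopy l a b : C := zeta + hscale l a * (r * dyroot C l ^+ b - zeta).

Lemma hscale_bounds l a : s0 <= hscale l a <= 1.
Proof.
have t1 : (minn a (2 ^ l))%:R * 2 ^- l <= 1 :> C.
  by rewrite ler_pdivrMr ?exprn_gt0 // mul1r -natrX ler_nat geq_minr.
have t0 : 0 <= (minn a (2 ^ l))%:R * 2 ^- l :> C by rewrite mulr_ge0 // invr_ge0 exprn_ge0.
rewrite /hscale lerDl mulr_ge0 ?subr_ge0 //=.
by rewrite -lerBrDl ler_piMr // subr_ge0.
Qed.

Lemma hscale_ge0 l a : 0 <= hscale l a.
Proof. by case/andP: (hscale_bounds l a) => h _; rewrite (le_trans (ltW s0_gt0)). Qed.

Lemma homotopy_double l a b : homotopy l.+1 a.*2 b.*2 = homotopy l a b.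
Proof.
have E : hscale l.+1 a.*2 = hscale l a.
  rewrite /hscale -mul2n expnS -minnMr natrM exprS.
  by field; rewrite expf_neq0 ?pnatr_eq0.
by rewrite /homotopy E -mul2n exprM dyrootS.
Qed.

Lemma homotopy_dist l a b : `|homotopy l a b - zeta| = hscale l a * `|r * dyroot C l ^+ b - zeta|.
Proof. by rewrite /homotopy [zeta + _]addrC addrK normrM ger0_norm // hscale_ge0. Qed.

Lemma circ_dist_le (u : C) : `|u| = r -> `|u - zeta| <= 2 * r.
Proof.
move=> ur; rewrite (le_trans (ler_normB _ _)) // ur mulr2n mulrDl mul1r lerD2l.
exact: ltW.
Qed.

Lemma homotopy_lipl l a b : `|homotopy l a.+1 b - homotopy l a b| <= 8 * r * 2 ^- l.
Proof.
have -> : homotopy l a.+1 b - homotopy l a b =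
  (1 - s0) * (((minn a.+1 (2 ^ l))%:R - (minn a (2 ^ l))%:R) * 2 ^- l) * (r * dyroot C l ^+ b - zeta).
  by rewrite /homotopy /hscale; ring.
have le1 : `|(minn a.+1 (2 ^ l))%:R - (minn a (2 ^ l))%:R| <= 1 :> C.
  rewrite -natrB; last by lia.
  by rewrite normr_nat (ler_nat _ _ 1); lia.
have les : `|1 - s0| <= 1 by rewrite ger0_norm ?subr_ge0 // gerBl ltW.
rewrite !normrM normfV normrX normr_nat.
have -> : 8 * r * 2 ^- l = 1 * (1 * 2 ^- l) * (8 * r) by ring.
have h : 0 <= 2 ^- l :> C by rewrite invr_ge0 exprn_ge0.
rewrite ler_pM ?mulr_ge0 //.
  by rewrite ler_pM ?mulr_ge0 // ler_pM.
rewrite (le_trans (circ_dist_le (norm_circ _ _))) // ler_wpM2r ?(ltW r0) //.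
by rewrite ler_nat.
Qed.

Lemma homotopy_lipr l a b : `|homotopy l a b.+1 - homotopy l a b| <= 8 * r * 2 ^- l.
Proof.
have -> : homotopy l a b.+1 - homotopy l a b = hscale l a * (r * dyroot C l ^+ b) * (dyroot C l - 1).
  by rewrite /homotopy exprS; ring.
rewrite normrM normrM norm_circ ger0_norm ?hscale_ge0 //.
have -> : 8 * r * 2 ^- l = 1 * r * (8 * 2 ^- l) by ring.
apply: ler_pM; rewrite ?dyroot_sub1_le ?mulr_ge0 ?hscale_ge0 ?(ltW r0) //.
by rewrite ler_wpM2r ?(ltW r0) //; case/andP: (hscale_bounds l a).
Qed.

(** Every node is a convex combination of [zeta] and a point of the circle, at distance at least
    [s0 * (r - |zeta|)] from [zeta]; both properties pass to limits. *)
Lemma homotopy_limit z : (forall t : C, 0 < t -> exists l a b, `|homotopy l a b - z| <= t) ->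
  `|z| <= r /\ z - zeta != 0.
Proof.
move=> Hz; split.
  rewrite real_leNgt ?normr_real ?gtr0_real //; apply/negP => rz.
  have t0 : 0 < (`|z| - r) / 2 by rewrite divr_gt0 // subr_gt0.
  have [l [a [b h]]] := Hz _ t0.
  have pr : `|homotopy l a b| <= r.
    have -> : homotopy l a b = (1 - hscale l a) * zeta + hscale l a * (r * dyroot C l ^+ b).
      by rewrite /homotopy; ring.
    case/andP: (hscale_bounds l a) => _ h1.
    rewrite (le_trans (ler_normD _ _)) // !normrM -[`|r| * _]normrM norm_circ.
    rewrite (ger0_norm (hscale_ge0 l a)) (@ger0_norm _ (1 - _)) ?subr_ge0 //.
    apply: (@le_trans _ _ ((1 - hscale l a) * r + hscale l a * r)); last first.
      by rewrite -mulrDl subrK mul1r.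
    by rewrite lerD2r ler_wpM2l ?subr_ge0 // ltW.
  have : `|z| <= r + (`|z| - r) / 2.
    rewrite -[z](subKr (homotopy l a b)) (le_trans (ler_normB _ _)) // lerD //.
    by rewrite subKr.
  have -> : r + (`|z| - r) / 2 = `|z| - (`|z| - r) / 2 by field.
  by rewrite lerBrDr gerDl => /le_lt_trans /(_ t0); rewrite ltxx.
apply/eqP => z0; have zz : z = zeta by apply/eqP; rewrite -subr_eq0 z0.
have t0 : 0 < s0 * (r - `|zeta|) / 2 by rewrite divr_gt0 // mulr_gt0.
have [l [a [b]]] := Hz _ t0; rewrite zz homotopy_dist => h.
have : s0 * (r - `|zeta|) <= s0 * (r - `|zeta|) / 2.
  apply: le_trans h; apply: ler_pM; rewrite ?(ltW s0_gt0) ?(ltW rho_gt0) //.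
    by case/andP: (hscale_bounds l a).
  exact/circ_dist/norm_circ.
rewrite ler_pdivlMr // mulr_natr mulr2n gerDl.
by move/le_lt_trans => /(_ _ (mulr_gt0 s0_gt0 rho_gt0)); rewrite ltxx.
Qed.

(** Goursat's lemma for the difference quotient of [F] at [zeta] on the ring swept by the homotopy:
    the two radial sides cancel, leaving the outer circle minus the shrunk one. *)
Lemma homotopy_avg (F : C -> C) (eps : C) :
  (forall z, `|z| <= r -> cdifferentiable F z) -> 0 < eps ->
  exists e0, forall e, (e0 <= e)%N ->
    `|avg e (fun z => (F z - F zeta) * (z / (z - zeta)))
      - avg e (fun z => (F (zeta + s0 * (z - zeta)) - F zeta) * (z / (z - zeta)))| <= eps.
Proof.
move=> Fd eps0; pose g z := (F z - F zeta) / (z - zeta).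
have gd z : (forall t : C, 0 < t -> exists l a b, `|homotopy l a b - z| <= t) ->
    cdifferentiable g z.
  case/homotopy_limit => zr' zz; apply: cdiffM.
    by apply: cdiffB; [apply: Fd | apply: cdiff_cst].
  by apply: cdiffV => //; apply: cdiffB; [apply: cdiff_id | apply: cdiff_cst].
have [e0 He0] := goursat Cc homotopy_double homotopy_lipl homotopy_lipr eps0 gd.
(* Two levels are skipped to reach roots of the form [dyroot l.+2], for which [|w - w^-1|] is
   bounded below. *)
exists e0.+2 => -[|[|e]] // e0e; set E := e.+2.
have := He0 E; rewrite block_boundary /= add0n !mul0n !add0n invr1 expr1n mulr1.
have hN : hscale E (2 ^ E) = 1.
  rewrite /hscale minnn natrX divff ?expf_neq0 ?pnatr_eq0 //; ring.
have h0 : hscale E 0 = s0 by rewrite /hscale min0n mul0r mulr0 addr0.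
(* The sides [b = 0] and [b = 2 ^ E] coincide. *)
rewrite big1 => [|i _]; last first.
  by rewrite !add0n /homotopy dyroot_exp expr0 subrr.
rewrite add0r sumrB.
have tr a s : hscale E a = s -> s != 0 -> 
    \sum_(j < 2 ^ E) trap g (homotopy E a (0 + j)) (homotopy E a (0 + j).+1) =
    (dyroot C E - (dyroot C E)^-1) / 2 * 2 ^+ E *
    avg E (fun z => (F (zeta + s * (z - zeta)) - F zeta) * (z / (z - zeta))).
  move=> <- sn; rewrite /homotopy trap_circle // /avg -(mulrA _ (2 ^+ E)) mulVKf //.
  by rewrite expf_neq0 // pnatr_eq0.
rewrite (tr _ _ hN) ?oner_neq0 // (tr _ _ h0) ?gt_eqF // -mulrBr normrM => /(_ _)H.
have {}H := H (leq_trans (leqnSn _) (leq_trans (leqnSn _) e0e)).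
(* The trapezoid sums are this factor times the averages; its modulus being at least 1, the bound
   passes to the averages. *)
have K : 1 <= `|(dyroot C E - (dyroot C E)^-1) / 2 * 2 ^+ E|.
  rewrite normrM normrM normfV normrX normr_nat.
  have := dyroot_subV_ge C e; rewrite ler_pdivrMr ?exprn_gt0 // => h.
  rewrite mulrAC ler_pdivlMr // mul1r (le_trans _ h) // ler_nat //.
rewrite (@eq_avg E _ (fun z => (F (zeta + 1 * (z - zeta)) - F zeta) * (z / (z - zeta)))).
  by apply: le_trans H; rewrite ler_peMl.
by move=> z _; rewrite mul1r [zeta + _]addrC subrK.
Qed.

End Homotopy.

(** The average is compared with the one shrunk by [s], where [F] is uniformly close to [F zeta] by
    continuity and the kernel is at most [r / (r - |zeta|)]. *)
Lemma cauchy_avg0 (F : C -> C) : (forall z, `|z| <= r -> cdifferentiable F z) ->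
  cvgC (fun e => avg e (fun z => (F z - F zeta) * (z / (z - zeta)))) 0.
Proof.
move=> Fd eps eps0; have e2 : 0 < eps / 2 by rewrite divr_gt0.
have e1 : 0 < eps / 2 * ((r - `|zeta|) / r) by rewrite mulr_gt0 // divr_gt0.
have [d d0 Hd] := cdiff_cont (Fd zeta (ltW zr)) e1.
(* Points of the circle are within [2 * r] of [zeta], so scaling by [d / (4 * r)] brings them within
   [d / 2]. *)
have [s [s0 s1 sd]] := pos_min2 ltr01 (divr_gt0 d0 (mulr_gt0 (ltr0n _ 4) r0)).
have [e0 He0] := homotopy_avg s0 s1 Fd e2.
exists e0 => e /He0 h; rewrite subr0.
set A := avg _ _ in h *; set B := avg _ _ in h.
rewrite -[A](subrK B) (le_trans (ler_normD _ _)) // [eps]splitr lerD //.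
apply: avg_le => z zr'; rewrite normrM normrM normfV zr'.
have dz := circ_dist zr'.
have -> : eps / 2 = eps / 2 * ((r - `|zeta|) / r) * (r / (r - `|zeta|)).
  by field; rewrite !gt_eqF.
apply: ler_pM => //; first by rewrite mulr_ge0 ?(ltW r0) // invr_ge0.
  apply: Hd; rewrite addrC addKr normrM (gtr0_norm s0).
  apply: (@le_lt_trans _ _ (d / (4 * r) * (2 * r))).
    by rewrite ler_pM ?(ltW s0) // circ_dist_le.
  have -> : d / (4 * r) * (2 * r) = d / 2 by field; rewrite gt_eqF.
  by rewrite ltr_pdivrMr // ltr_pMr // ltr1n.
rewrite ler_pM2l // lef_pV2 // posrE //; exact: lt_le_trans dz.
Qed.

(* Pairing the opposite roots [w ^+ j] and [- w ^+ j] halves the sum and squares [x]. *)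
Lemma sum_inv_1subM (w : nat -> C) e (x : C) :
  (forall l, w l.+1 ^+ 2 = w l) -> (forall l, w l.+1 ^+ (2 ^ l) = -1) ->
  x ^+ (2 ^ e) != 1 ->
  \sum_(j < 2 ^ e) (1 - x * w e ^+ j)^-1 = 2 ^+ e / (1 - x ^+ (2 ^ e)).
Proof.
move=> wS wN; elim: e x => [|e IH] x x1.
  by rewrite !expn0 big_ord1 expr0 mulr1 expr1 mul1r.
have we : w e ^+ (2 ^ e) = 1 by rewrite -wS -exprM mulnC exprM wN sqrrN expr1n.
have nz j : 1 - x ^+ 2 * w e ^+ j != 0.
  rewrite subr_eq0 eq_sym; apply: contra x1 => /eqP h.
  have /= := congr1 (fun t => t ^+ (2 ^ e)) (esym h).
  by rewrite expr1n exprMn -(exprM _ j) mulnC (exprM _ _ j) we expr1n mulr1 -exprM -expnS => ->.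
have sq j : 1 - x ^+ 2 * w e ^+ j = (1 - x * w e.+1 ^+ j) * (1 + x * w e.+1 ^+ j).
  by rewrite -wS -exprM mulnC exprM; ring.
have step (j : nat) : (1 - x * w e.+1 ^+ j)^-1 + (1 - x * w e.+1 ^+ (2 ^ e + j))^-1 =
     2 * (1 - x ^+ 2 * w e ^+ j)^-1.
  have := nz j; rewrite exprD wN mulN1r mulrN opprK sq mulf_eq0 negb_or => /andP[n1 n2].
  by field; rewrite n1 n2.
rewrite expnS mul2n -addnn big_split_ord /= -big_split /= addnn -mul2n.
under eq_bigr do rewrite step.
rewrite -mulr_sumr IH -?exprM -?expnS //.
by rewrite exprS mulrA.
Qed.

(** With [q = zeta / r] the kernel is [1 / (1 - q / w ^+ j)], whose average is exactly
    [1 / (1 - q ^+ (2 ^ e))]. *)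
Lemma avg_kernel : cvgC (fun e => avg e (fun z => z / (z - zeta))) 1.
Proof.
pose q := zeta / r; have q1 : `|q| < 1 by rewrite normrM normfV (gtr0_norm r0) ltr_pdivrMr // mul1r.
have qe e : q ^+ (2 ^ e) != 1.
  apply/eqP => h; have : `|q ^+ (2 ^ e)| < 1 by rewrite normrX exprn_ilt1 // -lt0n expn_gt0.
  by rewrite h normr1 ltxx.
apply: (@eq_cvgC _ (fun e => (1 - q ^+ (2 ^ e))^-1)) => [e|].
  rewrite /avg.
  have -> : \sum_(j < 2 ^ e) r * dyroot C e ^+ j / (r * dyroot C e ^+ j - zeta) =
            \sum_(j < 2 ^ e) (1 - q * (dyroot C e)^-1 ^+ j)^-1.
    apply: eq_bigr => j _; rewrite exprVn.
    have wj : dyroot C e ^+ j != 0 by rewrite expf_neq0 ?dyroot_neq0.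
    have n := circ_neq (norm_circ e j).
    have -> : 1 - q / dyroot C e ^+ j = (r * dyroot C e ^+ j - zeta) / (r * dyroot C e ^+ j).
      by rewrite /q; field; rewrite wj gt_eqF.
    by rewrite invf_div.
  rewrite (@sum_inv_1subM (fun l => (dyroot C l)^-1)) // => [|l|l].
  - by rewrite mulKf // expf_neq0 // pnatr_eq0.
  - by rewrite exprVn dyrootS.
  - by rewrite exprVn dyroot_neg invrN1.
have := @cdiff_cvg _ (fun t => (1 - t)^-1) (fun e => q ^+ (2 ^ e)) 0.
rewrite subr0 invr1; apply.
  apply: cdiffV; rewrite ?subr0 ?oner_neq0 //.
  by apply: cdiffB; [apply: cdiff_cst | apply: cdiff_id].
by apply: cvgC_exp => // n; apply/ltnW/ltn_expl.
Qed.

(** On the circle [z / (z - zeta)] is the density of [dz / (2 i pi (z - zeta))] with respect to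
    normalized arc length, so this is Cauchy's formula. *)
Lemma cauchy_avg (F : C -> C) : (forall z, `|z| <= r -> cdifferentiable F z) ->
  cvgC (fun e => avg e (fun z => F z * (z / (z - zeta)))) (F zeta).
Proof.
move=> Fd; have := cvgCD (cauchy_avg0 Fd) (cvgCM (F zeta) avg_kernel).
rewrite add0r mulr1; apply: eq_cvgC => e.
by rewrite -avgM -avgD; apply: eq_avg => z _; rewrite -mulrDl subrK.
Qed.

End CauchyFormula.

(** * The Pick matrix *)

Section Pick.
Variable C : numClosedFieldType.
Hypothesis Cc : real_complete C.
Variables (f : C -> C) (M : nat) (zeta : 'I_M -> C).
Hypothesis fd : forall z, `|z| < 1 -> cdifferentiable f z.
Hypothesis f1 : forall z, `|z| < 1 -> `|f z| <= 1.

Section Radius.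
Variable r : C.
Hypotheses (r0 : 0 < r) (r1 : r < 1) (zr : forall k, `|zeta k| < r).

(** A combination of the Szego kernels of the disc of radius [r] at the points [zeta k]. *)
Definition szego (c : 'I_M -> C) (z : C) : C :=
  \sum_k c k / (1 - (zeta k)^* * z / r ^+ 2).

Lemma szego_den_neq0 k z : `|z| <= r -> 1 - (zeta k)^* * z / r ^+ 2 != 0.
Proof.
move=> zr'; rewrite subr_eq0 eq_sym; apply/eqP => h.
have : `|(zeta k)^* * z / r ^+ 2| < 1.
  rewrite normrM normfV ltr_pdivrMr ?normr_gt0 ?expf_neq0 ?gt_eqF //.
  rewrite normrM norm_conjC mul1r normrX (gtr0_norm r0) expr2.
  by rewrite (le_lt_trans (ler_wpM2l _ zr')) // ltr_pM2r.
by rewrite h normr1 ltxx.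
Qed.

Lemma szego_diff c z : `|z| <= r -> cdifferentiable (szego c) z.
Proof.
move=> zr'; apply: cdiff_sum => k; apply: cdiffM; first exact: cdiff_cst.
apply: cdiffV; first exact: szego_den_neq0.
apply: cdiffB; first exact: cdiff_cst.
apply: cdiffM; last exact: cdiff_cst.
by apply: cdiffM; [apply: cdiff_cst | apply: cdiff_id].
Qed.

(** On the circle [z^* = r ^+ 2 / z], which turns the conjugate Szego kernel into the Cauchy
    kernel. *)
Lemma szego_conj c z : `|z| = r -> (szego c z)^* = \sum_k (c k)^* * (z / (z - zeta k)).
Proof.
move=> zr'; rewrite rmorph_sum; apply: eq_bigr => k _.
have z0 : z != 0 by rewrite -normr_gt0 zr'.
have zk : z - zeta k != 0 by rewrite (circ_neq (zr k)).
have rr : r^* = r by apply: conj_Creal; rewrite gtr0_real.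
rewrite rmorphM fmorphV rmorphB rmorph1 !rmorphM fmorphV rmorphXn /=. rewrite conjCK rr.
have -> : r ^+ 2 = z * z^* by rewrite -normCK zr'.
congr (_ * _); have -> : 1 - zeta k * z^* / (z * z^*) = (z - zeta k) / z.
  by field; rewrite z0 conjC_eq0 z0.
by rewrite invf_div.
Qed.

Lemma szego_reproducing c (F : C -> C) : (forall z, `|z| <= r -> cdifferentiable F z) ->
  cvgC (fun e => avg r e (fun z => F z * (szego c z)^*)) (\sum_k (c k)^* * F (zeta k)).
Proof.
move=> Fd; have := @cvgC_sum _ _ (index_enum _)
  (fun k e => (c k)^* * avg r e (fun z => F z * (z / (z - zeta k))))
  (fun k => (c k)^* * F (zeta k)).
move=> /(_ (fun k => cvgCM _ (cauchy_avg Cc r0 (zr k) Fd))).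
apply: eq_cvgC => e.
under eq_bigr do rewrite -avgM.
rewrite -avg_sum; apply: eq_avg => // z zr'.
by rewrite szego_conj // mulr_sumr; apply: eq_bigr => k _; rewrite mulrCA.
Qed.

(* With [h = sum_k c_k k_k] and [g = T h], where [T k_k = conj (f z_k) k_k] is the adjoint of
   multiplication by [f], the averages of [|h - f g|^2 + (1 - |f|^2) |g|^2 >= 0]
   converge to [|h|^2 - |g|^2]. *)
Lemma pick_radius (v : 'I_M -> C) : 0 <= \sum_j \sum_k
  (v j)^* * ((1 - (f (zeta j))^* * f (zeta k)) / (1 - (zeta j)^* * zeta k / r ^+ 2)) * v k.
Proof.
(* The coefficients are conjugated so that [v] ends up unconjugated on the right, as in [psd]. *)
pose c k := (v k)^*; pose c' k := (f (zeta k))^* * c k.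
pose h := szego c; pose g := szego c'.
have lt1 z : `|z| <= r -> `|z| < 1 by move=> /le_lt_trans; apply.
have hd : forall z, `|z| <= r -> cdifferentiable h z by apply: szego_diff.
have gd : forall z, `|z| <= r -> cdifferentiable g z by apply: szego_diff.
have fgd z : `|z| <= r -> cdifferentiable (fun z => f z * g z) z.
  by move=> zr'; apply: cdiffM; [apply/fd/lt1 | apply: gd].
have cvh := szego_reproducing c hd; have cvg := szego_reproducing c' gd.
have cvf := szego_reproducing c fgd.
have cvf' := cvgC_conj cvf.
set H := \sum_k _ in cvh; set A := \sum_k _ in cvf cvf'; set G := \sum_k _ in cvg.
(* The adjoint relation: the inner product of [f g] with [h] equals that of [g] with itself. *)
have AG : A = G.
  by apply: eq_bigr => k _; rewrite /c' rmorphM /= conjCK; ring.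
have G0 : 0 <= G.
  apply: cvgC_ge0 cvg => e; apply: avg_ge0 => // z _; rewrite -normCK exprn_ge0 //.
have : 0 <= H - A - A^* + G.
  apply: cvgC_ge0 (cvgCD (cvgCB (cvgCB cvh cvf) cvf') cvg) => e.
  rewrite -avg_conj -!avgB -avgD; apply: avg_ge0 => // z zr'.
  have -> : h z * (h z)^* - f z * g z * (h z)^* - (f z * g z * (h z)^*)^* + g z * (g z)^*
    = (h z - f z * g z) * (h z - f z * g z)^* + (1 - f z * (f z)^*) * (g z * (g z)^*).
    by rewrite !rmorphB !rmorphM /= conjCK; ring.
  rewrite -!normCK addr_ge0 ?mulr_ge0 ?exprn_ge0 // subr_ge0.
  by rewrite exprn_ile1 // f1 // lt1 // zr'.
rewrite AG (conj_Creal (ger0_real G0)) subrK.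
move=> HG0; apply: (le_trans HG0); rewrite le_eqVlt; apply/orP; left; apply/eqP.
rewrite -AG /H /A -sumrB exchange_big /=; apply: eq_bigr => k _.
rewrite /h /g /szego mulr_sumr mulr_sumr mulr_sumr -sumrB; apply: eq_bigr => j _.
rewrite /c' /c conjCK mulrAC; ring.
Qed.

End Radius.

Lemma pos_min_fin (I : finType) (u : I -> C) : (forall i, 0 < u i) ->
  exists2 d : C, 0 < d & forall i, d <= u i.
Proof.
move=> u0; suff [d d0 H] : exists2 d : C, 0 < d & forall i, i \in enum I -> d <= u i.
  by exists d => // i; apply: H; rewrite mem_enum.
elim: (enum I) => [|i s [d d0 H]]; first by exists 1.
have [t [t0 td tu]] := pos_min2 d0 (u0 i).
exists t => // k; rewrite inE => /orP[/eqP->//|/H]; exact: le_trans.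
Qed.

(** The radius tends to 1: the form at [r = (1 + s)^-1] is [L (1 + s)], and [L] is continuous at
    1. *)
Theorem pick_necessity : (forall k, `|zeta k| < 1) ->
  psd (\matrix_(j < M, k < M)
         ((1 - (f (zeta j))^* * f (zeta k)) / (1 - (zeta j)^* * zeta k))).
Proof.
move=> z1 v.
have [d d0 Hd] := pos_min_fin (fun k => etrans (subr_gt0 _ _) (z1 k)).
pose L s := \sum_j \sum_k (v j 0)^* *
  ((1 - (f (zeta j))^* * f (zeta k)) / (1 - (zeta j)^* * zeta k * s ^+ 2)) * v k 0.
have n1 j k : 1 - (zeta j)^* * zeta k * 1 ^+ 2 != 0.
  rewrite expr1n mulr1 subr_eq0 eq_sym; apply/eqP => h.
  have : `|(zeta j)^* * zeta k| < 1.
    by rewrite normrM norm_conjC mulr_ilt1.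
  by rewrite h normr1 ltxx.
have Ld : cdifferentiable L 1.
  apply: cdiff_sum => j; apply: cdiff_sum => k.
  apply: cdiffM; last exact: cdiff_cst.
  apply: cdiffM; first exact: cdiff_cst.
  apply: cdiffM; first exact: cdiff_cst.
  apply: (@cdiffV _ (fun s => 1 - (zeta j)^* * zeta k * s ^+ 2)); first exact: n1.
  apply: cdiffB; first exact: cdiff_cst.
  apply: cdiffM; first exact: cdiff_cst.
  by apply: cdiffM; apply: cdiff_id.
have -> : \sum_j \sum_k (v j 0)^* * (\matrix_(j < M, k < M)
         ((1 - (f (zeta j))^* * f (zeta k)) / (1 - (zeta j)^* * zeta k))) j k * v k 0 = L 1.
  by apply: eq_bigr => j _; apply: eq_bigr => k _; rewrite mxE expr1n mulr1.
apply: nonneg_closed => eps eps0.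
have [t t0 Ht] := cdiff_cont Ld eps0.
(* [s <= d] gives [|zeta k| <= 1 - s < (1 + s)^-1], so all nodes lie in the smaller disc. *)
have [s [s0 sd st]] := pos_min2 d0 (divr_gt0 t0 (ltr0n _ 2)).
have s1 : 1 < 1 + s by rewrite ltrDl.
have s10 : 0 < 1 + s := lt_trans ltr01 s1.
exists (L (1 + s)); last first.
  apply: Ht; rewrite [1 + s]addrC addrK gtr0_norm // (le_lt_trans st) //.
  by rewrite ltr_pdivrMr // ltr_pMr // ltr1n.
have := @pick_radius (1 + s)^-1; rewrite invr_gt0 s10 invf_lt1 // s1 => /(_ isT isT).
rewrite /L exprVn invrK; apply.
move=> k; rewrite -[_^-1]mul1r ltr_pdivlMr //.
have zk : `|zeta k| <= 1 - s.
  by rewrite lerBrDl -lerBrDr (le_trans sd).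
rewrite (le_lt_trans (ler_wpM2r (ltW s10) zk)) //.
have -> : (1 - s) * (1 + s) = 1 - s ^+ 2 by ring.
by rewrite gtrBl exprn_gt0.
Qed.

End Pick.

(** * The rational function of a matrix in the domain *)

Section PrincipalMinors.
Variable R : comNzRingType.

(** An injection between ordinals of equal size is a permutation; acting on both rows and columns,
    its sign appears squared. *)
Lemma det_mxsub_inj m n (e : m = n) (s : 'I_m -> 'I_n) (A : 'M[R]_n) : injective s ->
  \det (mxsub s s A) = \det A.
Proof.
case: _ / e in s A * => sI.
have -> : mxsub s s A = row_perm (perm sI) (col_perm (perm sI) A).
  by apply/matrixP => i j; rewrite !mxE !permE.
rewrite row_permE col_permE !det_mulmx !det_perm mulrCA -signr_addb odd_permV addbb mulr1.
by [].
Qed.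

Variable n : nat.
Implicit Types (A : 'M[R]_n) (S : {set 'I_n}).

(** Lists [S] first and then its complement, to put matrices into block form. *)
Definition set_split S (x : 'I_(#|S| + #|~: S|)) : 'I_n :=
  match split x with inl a => enum_val a | inr b => enum_val b end.

Lemma set_split_inj S : injective (@set_split S).
Proof.
move=> x y; rewrite /set_split; case: (splitP x) => a xa; case: (splitP y) => b yb h.
- by apply: val_inj; rewrite /= xa yb (enum_val_inj h).
- by have := enum_valP a; have := enum_valP b; rewrite -h inE => /negPf->.
- by have := enum_valP a; have := enum_valP b; rewrite -h inE => ->.
- by apply: val_inj; rewrite /= xa yb (enum_val_inj h).
Qed.

(** In the order of [set_split] the matrix is block upper triangular, with an identity block for the
    complement of [S]. *)
Lemma det_rows_id A S : \det (\matrix_(i, j) (if i \in S then A i j else (i == j)%:R)) =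
  \det (\matrix_(a < #|S|, b < #|S|) A (enum_val a) (enum_val b)).
Proof.
set B := \matrix_(i, j) _; have e : (#|S| + #|~: S|)%N = n by rewrite cardsC card_ord.
rewrite -(det_mxsub_inj e B (@set_split_inj S)).
rewrite -[mxsub _ _ _]submxK (_ : dlsubmx _ = 0).
  rewrite det_ublock (_ : drsubmx _ = 1%:M) ?det1 ?mulr1.
    congr (\det _); apply/matrixP => a b; rewrite !mxE /set_split.
    by rewrite (unsplitK (inl a)) (unsplitK (inl b)) enum_valP.
  apply/matrixP => a b; rewrite !mxE /set_split.
  rewrite (unsplitK (inr a)) (unsplitK (inr b)) (inj_eq enum_val_inj).
  by have := enum_valP a; rewrite inE => /negPf->.
apply/matrixP => a b; rewrite !mxE /set_split (unsplitK (inr a)) (unsplitK (inl b)).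
have := enum_valP a; rewrite inE => /[dup] h /negPf->.
case: eqP => // h'; have := enum_valP b.
by rewrite -h' (negPf h).
Qed.

(** Distributing the Leibniz products of sums of two entries selects the set [S] of rows taken from
    [A]; the other rows come from the identity. *)
Lemma det_addmx1 A : \det (A + 1%:M) =
  \sum_(S : {set 'I_n}) \det (\matrix_(a < #|S|, b < #|S|) A (enum_val a) (enum_val b)).
Proof.
rewrite /determinant.
under eq_bigr => s _.
  under eq_bigr do rewrite mxE.
  rewrite bigA_distr mulr_sumr.
  over.
rewrite exchange_big; apply: eq_bigr => S _ /=.
rewrite -[RHS]det_rows_id; apply: eq_bigr => s _; congr (_ * _).
by apply: eq_bigr => i _; rewrite !mxE; case: ifP.
Qed.

End PrincipalMinors.

(** * The polynomials [P] and [Q] and the bound on their quotient *)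

Section PsiBound.
Variables (C : numClosedFieldType) (n : nat) (A : 'M[C]_n).

(** As [X] is diagonal, a principal submatrix of [- A X] is that of [A] times a diagonal matrix. *)
Lemma det_sub_E1n z w : \det (1%:M - A *m E1n n z w) =
  \sum_(S : {set 'I_n}) pminor A S * \prod_(i in S) - (if val i == 0%N then w else z).
Proof.
rewrite addrC det_addmx1; apply: eq_bigr => S _.
pose D : 'rV[C]_#|S| := \row_a - (if val (enum_val a) == 0%N then w else z).
have -> : \prod_(i in S) - (if val i == 0%N then w else z) = \det (diag_mx D).
  rewrite det_diag big_enum_val; apply: eq_bigr => a _; by rewrite mxE.
rewrite -det_mulmx; congr (\det _); apply/matrixP => a b.
rewrite mul_mx_diag !mxE (bigD1 (enum_val b)) //= big1 ?addr0 => [|k kb].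
  by rewrite mxE eqxx mulrN.
by rewrite mxE (negPf kb) mulr0.
Qed.

Hypothesis n0 : (0 < n)%N.

Lemma sum_by_index (I : finType) (P : pred I) (k : I -> nat) (c : I -> C) (F : nat -> C) m :
  (forall i, P i -> (k i < m)%N) ->
  \sum_(j < m) F j * (\sum_(i | (k i == j) && P i) c i) = \sum_(i | P i) F (k i) * c i.
Proof.
move=> km; under eq_bigr do rewrite mulr_sumr.
rewrite (exchange_big_dep P) /= => [|j i _ /andP[]//]; apply: eq_bigr => i Pi.
rewrite (big_pred1 (Ordinal (km i Pi))) // => j.
by rewrite Pi andbT eq_sym.
Qed.

Lemma det_dim0 m (B : 'M[C]_m) : m = 0%N -> \det B = 1.
Proof. by move=> e; case: _ / (esym e) in B *; rewrite det_mx00. Qed.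

(** A set [S] containing the first index contributes one factor [- w] and [#|S| - 1] factors [- z],
    the others only factors [- z]; sorting by size gives [P] and [Q]. *)
Lemma det_PQ z w : \det (1%:M - A *m E1n n z w) = (Qpoly A).[z] - w * (Ppoly A).[z].
Proof.
pose i0 := Ordinal n0.
have mem0 (S : {set 'I_n}) : [exists i in S, val i == 0%N] = (i0 \in S).
  apply/existsP/idP => [[i /andP[iS /eqP i00]]|h]; last by exists i0; rewrite h /=.
  by rewrite (_ : i0 = i) //; apply: val_inj.
have mem0' (S : {set 'I_n}) : [forall i in S, val i != 0%N] = (i0 \notin S).
  by rewrite -mem0 negb_exists; apply: eq_forallb => i; rewrite negb_and implybE.
have prodz (S : {set 'I_n}) : i0 \notin S ->
    \prod_(i in S) - (if val i == 0%N then w else z) = (- z) ^+ #|S|.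
  move=> h; rewrite (eq_bigr (fun=> - z)) ?prodr_const // => i iS.
  case: eqP => // i00; case/negP: h; rewrite (_ : i0 = i) //; exact: val_inj.
have prodw (S : {set 'I_n}) : i0 \in S ->
    \prod_(i in S) - (if val i == 0%N then w else z) = - w * (- z) ^+ #|S|.-1.
  move=> h; rewrite (bigD1 i0) //= (eq_bigr (fun=> - z)) => [|i /andP[_ ii0]]; last first.
    by case: ifP => // /eqP i00; case/eqP: ii0; apply: val_inj.
  by rewrite prodr_const (cardsD1 i0 S) h; congr (_ * _ ^+ _); apply: eq_card => i; rewrite !inE andbC.
rewrite det_sub_E1n (bigID (fun S : {set 'I_n} => i0 \in S)) /= addrC; congr (_ + _).
  rewrite horner_poly (eq_bigr (fun j : 'I_n => (- z) ^+ j * Yc A j)); last first.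
    move=> j _; rewrite [in RHS](exprNn z) [RHS]mulrAC; congr (_ * _).
    (* The constant coefficient 1 of [Q] is the empty minor. *)
    case: (val j =P 0%N) => [->|//]. rewrite expr0 mul1r.
    rewrite /Yc (big_pred1 set0); last first.
      move=> S; rewrite /= cards_eq0; case: eqP => // ->.
      by rewrite mem0' inE.
    by rewrite /pminor det_dim0 // cards0.
  rewrite /Yc; under [RHS]eq_bigr do under eq_bigl do rewrite mem0'.
  rewrite (@sum_by_index _ (fun S : {set 'I_n} => i0 \notin S) (fun S => #|S|)
    (fun S => pminor A S) (fun j => (- z) ^+ j)) => [|S h].
    by apply: eq_bigr => S h; rewrite prodz // mulrC.
  have : S \proper [set: 'I_n] by rewrite properT; apply: contraNneq h => ->; rewrite inE.
  by move/proper_card; rewrite cardsT card_ord.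
rewrite horner_poly -mulNr mulr_sumr.
rewrite (eq_bigr (fun j : 'I_n => - w * (- z) ^+ j * Xc A j.+1)); last first.
  by move=> j _; rewrite [in RHS](exprNn z); ring.
rewrite /Xc; under [RHS]eq_bigr do under eq_bigl do rewrite mem0.
have S0 (S : {set 'I_n}) : i0 \in S -> (0 < #|S|)%N by move=> h; apply/card_gt0P; exists i0.
have idx (S : {set 'I_n}) j : (#|S| == j.+1) && (i0 \in S) = (#|S|.-1 == j) && (i0 \in S).
  by case: (boolP (i0 \in S)) => [/S0|]; rewrite ?andbF // !andbT; case: #|S|.
under [RHS]eq_bigr do under eq_bigl do rewrite idx.
rewrite (@sum_by_index _ (fun S : {set 'I_n} => i0 \in S) (fun S => #|S|.-1)
  (fun S => pminor A S) (fun j => - w * (- z) ^+ j)) => [|S h].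
  by apply: eq_bigr => S h; rewrite prodw // mulrC.
by rewrite prednK ?S0 //; have := max_card (mem S); rewrite card_ord.
Qed.

Hypothesis AO : Omega1n A.

(** A diagonal matrix with entries in the closed disc has norm at most 1, below the bound [r > 1] of
    [Omega1n]. *)
Lemma Omega_det_neq0 z w : `|z| <= 1 -> `|w| <= 1 -> \det (1%:M - A *m E1n n z w) != 0.
Proof.
move=> z1 w1; apply/eqP => d0; case: AO => r [r1 H].
have := H z w d0 1;
have op : opnorm_le (E1n n z w) 1.
  split=> // v; rewrite expr1n mul1r; apply: ler_sum => i _.
  rewrite ler_pXn2r ?nnegrE // mxE (bigD1 i) //= big1 ?addr0 => [|k ki].
    by rewrite mxE eqxx normrM ler_piMl //; case: ifP.
  by rewrite mxE eq_sym (negPf ki) mul0r.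
by move=> /(_ op) /(lt_le_trans r1); rewrite ltxx.
Qed.

Lemma Qpoly_neq0 z : `|z| <= 1 -> (Qpoly A).[z] != 0.
Proof.
move=> z1; have := @Omega_det_neq0 z 0 z1; rewrite normr0 det_PQ mul0r subr0; exact.
Qed.

(** If [|P / Q| > 1], then [w = Q / P] lies in the disc and annihilates [Q - w P]. *)
Lemma PQ_le1 z : `|z| <= 1 -> `|(Ppoly A).[z] / (Qpoly A).[z]| <= 1.
Proof.
move=> z1; have Q0 := Qpoly_neq0 z1.
rewrite real_leNgt ?normr_real ?real1 //; apply/negP => h.
have P0 : (Ppoly A).[z] != 0.
  by apply: contraTneq h => ->; rewrite mul0r normr0 ltr10.
have := @Omega_det_neq0 z ((Qpoly A).[z] / (Ppoly A).[z]) z1.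
rewrite det_PQ divfK // subrr eqxx => /(_ _)/notF; apply.
by rewrite -invf_div normfV invf_le1 ?ltW // normr_gt0 mulf_neq0 ?invr_eq0.
Qed.

(** [Q] does not vanish at [z], hence neither do its factors [Qred] and the gcd, and cancelling
    preserves the value there. *)
Lemma PsiE z : `|z| <= 1 -> (Qred A).[z] != 0 /\ Psi A z = (Ppoly A).[z] / (Qpoly A).[z].
Proof.
move=> /Qpoly_neq0; set g := gcdp (Ppoly A) (Qpoly A).
have PE : Ppoly A = Pred A * g by rewrite divpK // dvdp_gcdl.
have QE : Qpoly A = Qred A * g by rewrite divpK // dvdp_gcdr.
rewrite {1}QE hornerM mulf_eq0 negb_or => /andP[Q0 g0]; split=> //.
by rewrite /Psi PE QE !hornerM -mulf_div divff // mulr1.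
Qed.

End PsiBound.

(** * Application to the map [F] *)

Lemma cdiff_det_E1n (C : numClosedFieldType) (n : nat) (F : C -> 'M[C]_n) z w x :
  (forall i j, cdifferentiable (fun u => F u i j) x) ->
  cdifferentiable (fun u => \det (1%:M - F u *m E1n n z w)) x.
Proof.
move=> Fx; apply: cdiff_det => i j.
apply: (@eq_cdiff _ (fun u => (i == j)%:R - \sum_k F u i k * E1n n z w k j)) => [u|].
  by rewrite !mxE.
apply: cdiffB; first exact: cdiff_cst.
by apply: cdiff_sum => k; apply: cdiffM => //; apply: cdiff_cst.
Qed.

Theorem theorem2 (C : numClosedFieldType) (Ccomplete : real_complete C)
  (n : nat) (hn : (2 <= n)%N) (M : nat)
  (zeta : 'I_M -> C) (W : 'I_M -> 'M[C]_n)
  (hzeta_inj : injective zeta) (hzeta : forall j, in_disc (zeta j))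
  (hW : forall j, Omega1n (W j)) :
  (exists F : C -> 'M[C]_n,
      holo_disc_mx F /\ (forall z, in_disc z -> Omega1n (F z)) /\
      (forall j, F (zeta j) = W j)) ->
  forall z : C, in_cdisc z ->
    (forall j, (Qred (W j)).[z] != 0) /\
    psd (\matrix_(j < M, k < M)
           ((1 - (Psi (W j) z)^* * Psi (W k) z) / (1 - (zeta j)^* * zeta k))).
Proof.
move=> [F [Fholo [FO FW]]] z z1; have n0 : (0 < n)%N := ltnW hn.
split=> [j|]; first by case: (PsiE n0 (hW j) z1).
pose f u := (Ppoly (F u)).[z] / (Qpoly (F u)).[z].
have PsiW j : Psi (W j) z = f (zeta j).
  by rewrite /f FW; case: (PsiE n0 (hW j) z1).
under eq_mx do rewrite !PsiW.
apply: (@pick_necessity _ Ccomplete f) => [u u1|u u1|//]; last first.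
  by apply: (PQ_le1 n0) => //; apply: FO.
(* [Q] is the determinant at [w = 0], and [P] is the determinant at [w = 0] minus the one at
   [w = 1]; this makes both holomorphic in [v]. *)
have Qd : cdifferentiable (fun v => (Qpoly (F v)).[z]) u.
  apply: (eq_cdiff _ (cdiff_det_E1n z 0 (Fholo u u1))) => v /=.
  by rewrite (det_PQ _ n0) mul0r subr0.
have Pd : cdifferentiable (fun v => (Ppoly (F v)).[z]) u.
  apply: (eq_cdiff _ (cdiffB Qd (cdiff_det_E1n z 1 (Fholo u u1)))) => v /=.
  by rewrite (det_PQ _ n0) mul1r subKr.
by apply: cdiffM => //; apply: cdiffV => //; apply: (Qpoly_neq0 n0) => //; apply: FO.
Qed.
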